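(* Let $\mathcal{C}$ be a symmetric monoidal category. The category $\mathsf{SplitExt}(\mathsf{BiAlg}_{\mathcal{C}})$ of split extensions of (non-associative) bialgebras in $\mathcal{C}$ and the category $\mathsf{Act}(\mathsf{BiAlg}_{\mathcal{C}})$ of actions of (non-associative) bialgebras in $\mathcal{C}$ are equivalent.
   Context: $(\mathcal{C},\otimes,I,\sigma)$ is a symmetric monoidal category (associativity and unit isomorphisms are suppressed); $f\cdot g$ denotes composition ($g$ first) and $1_X$ the identity of $X$. An algebra is an object $A$ with morphisms $m\colon A\otimes A\to A$, $u_A\colon I\to A$ with $m\cdot(u_A\otimes 1_A)=1_A=m\cdot(1_A\otimes u_A)$; associativity is NOT required. Algebra morphisms preserve $m$ and $u$. A coalgebra $(C,\Delta,\epsilon_C)$ is coassociative and counital; coalgebra morphisms preserve $\Delta$ and $\epsilon$. A bialgebra (meaning non-associative bialgebra) is $(B,m,u_B,\Delta,\epsilon_B)$, with $(B,m,u_B)$ an algebra, $(B,\Delta,\epsilon_B)$ a coalgebra, and $\Delta\cdot m=(m\otimes m)\cdot(1_B\otimes\sigma_{B,B}\otimes 1_B)\cdot(\Delta\otimes\Delta)$, $\Delta\cdot u_B=u_B\otimes u_B$, $\epsilon_B\cdot m=\epsilon_B\otimes\epsilon_B$, $\epsilon_B\cdot u_B=1_I$. A bialgebra morphism is a morphism of algebras and of coalgebras. Action of bialgebras: for bialgebras $B,X$, a morphism $\triangleright\colon B\otimes X\to X$ in $\mathcal{C}$ such that $\triangleright\cdot(u_B\otimes 1_X)=1_X$; $\triangleright\cdot(1_B\otimes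 u_X)=u_X\cdot\epsilon_B$; $(1_B\otimes\triangleright)\cdot(\Delta\otimes 1_X)=(1_B\otimes\triangleright)\cdot(\sigma_{B,B}\otimes 1_X)\cdot(\Delta\otimes 1_X)$; $\epsilon_X\cdot\triangleright=\epsilon_B\otimes\epsilon_X$; $\Delta\cdot\triangleright=(\triangleright\otimes\triangleright)\cdot(1_B\otimes\sigma_{B,X}\otimes 1_X)\cdot(\Delta\otimes\Delta)$. A morphism from $\triangleright\colon B\otimes X\to X$ to $\triangleright'\colon B'\otimes X'\to X'$ is a pair of bialgebra morphisms $g\colon B\to B'$, $v\colon X\to X'$ with $v\cdot\triangleright=\triangleright'\cdot(g\otimes v)$. These form $\mathsf{Act}(\mathsf{BiAlg}_{\mathcal{C}})$. Split extension of bialgebras: bialgebras $X,A,B$, bialgebra morphisms $\kappa\colon X\to A$, $\alpha\colon A\to B$, $e\colon B\to A$ and a morphism $\lambda\colon A\to X$ in $\mathcal{C}$ such that (1) $\lambda\cdot\kappa=1_X$, $\alpha\cdot e=1_B$; (2) $\lambda\cdot e=u_X\cdot\epsilon_B$, $\alpha\cdot\kappa=u_B\cdot\epsilon_X$; (3) $m\cdot((\kappa\cdot\lambda)\otimes(e\cdot\alpha))\cdot\Delta=1_A$; (4) $\lambda\cdot m\cdot(\kappa\otimes e)=1_X\otimes\epsilon_B$; (5) $(1_B\otimes\lambda)\cdot(1_B\otimes m)\cdot(1_B\otimes e\otimes\kappa)\cdot(\Delta\otimes 1_X)=(1_B\otimes\lambda)\cdot(1_B\otimes m)\cdot(1_B\otimes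 e\otimes\kappa)\cdot(\sigma_{B,B}\otimes 1_X)\cdot(\Delta\otimes 1_X)$; (6) $m\cdot(m\otimes 1_A)\cdot(\kappa\otimes e\otimes 1_A)=m\cdot(1_A\otimes m)\cdot(\kappa\otimes e\otimes 1_A)$; (7) $m\cdot(m\otimes 1_A)\cdot(\kappa\otimes 1_A\otimes e)=m\cdot(1_A\otimes m)\cdot(\kappa\otimes 1_A\otimes e)$; (8) $m\cdot(m\otimes 1_A)\cdot(1_A\otimes\kappa\otimes e)=m\cdot(1_A\otimes m)\cdot(1_A\otimes\kappa\otimes e)$; (9) $\lambda$ is a morphism of coalgebras preserving the unit. A morphism from $(X,A,B,\kappa,\alpha,e,\lambda)$ to $(X',A',B',\kappa',\alpha',e',\lambda')$ is a triple $(g,v,p)$ of bialgebra morphisms $g\colon B\to B'$, $v\colon X\to X'$, $p\colon A\to A'$ with $p\cdot\kappa=\kappa'\cdot v$, $p\cdot e=e'\cdot g$, $\alpha'\cdot p=g\cdot\alpha$, $\lambda'\cdot p=v\cdot\lambda$. These form $\mathsf{SplitExt}(\mathsf{BiAlg}_{\mathcal{C}})$. *)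

(* Defs.v *)
From Stdlib Require Import ProofIrrelevance.

Set Implicit Arguments.
Unset Strict Implicit.
Unset Printing Implicit Defensive.

Declare Scope cat_scope.
Delimit Scope cat_scope with cat.
Local Open Scope cat_scope.

Record Category := {
  Obj : Type;
  Hom : Obj -> Obj -> Type;
  idm : forall X, Hom X X;
  comp : forall X Y Z, Hom Y Z -> Hom X Y -> Hom X Z;
  comp_idl : forall X Y (f : Hom X Y), comp (idm Y) f = f;
  comp_idr : forall X Y (f : Hom X Y), comp f (idm X) = f;
  comp_assoc : forall W X Y Z (f : Hom Y Z) (g : Hom X Y) (h : Hom W X),
    comp f (comp g h) = comp (comp f g) h
}.

Arguments Hom {C} X Y : rename.
Arguments idm {C} X : rename.
Arguments comp {C X Y Z} f g : rename.

Notation "f ∘ g" := (comp f g) (at level 40, left associativity) : cat_scope.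
Notation "1_ X" := (idm X) (at level 1, X at level 1, format "1_ X") : cat_scope.

Record Functor (C D : Category) := {
  fobj :> Obj C -> Obj D;
  fmap : forall X Y, Hom X Y -> Hom (fobj X) (fobj Y);
  fmap_id : forall X, fmap 1_X = 1_(fobj X);
  fmap_comp : forall X Y Z (f : Hom Y Z) (g : Hom X Y),
    fmap (f ∘ g) = fmap f ∘ fmap g
}.

Arguments fmap {C D} F {X Y} f : rename.

Definition functor_id (C : Category) : Functor C C :=
  {| fobj := fun X => X;
     fmap := fun X Y f => f;
     fmap_id := fun X => eq_refl;
     fmap_comp := fun X Y Z f g => eq_refl |}.

Definition functor_comp (C D E : Category) (G : Functor D E) (F : Functor C D) :
  Functor C E.
Proof.
  refine {| fobj := fun X => G (F X);
            fmap := fun X Y f => fmap G (fmap F f) |}.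
  - intros X. now rewrite !fmap_id.
  - intros X Y Z f g. now rewrite !fmap_comp.
Defined.

Record NatIso (C D : Category) (F G : Functor C D) := {
  ni_hom : forall X, Hom (F X) (G X);
  ni_inv : forall X, Hom (G X) (F X);
  ni_natural : forall X Y (f : Hom X Y), ni_hom Y ∘ fmap F f = fmap G f ∘ ni_hom X;
  ni_hom_inv : forall X, ni_hom X ∘ ni_inv X = 1_(G X);
  ni_inv_hom : forall X, ni_inv X ∘ ni_hom X = 1_(F X)
}.

Definition equivalent_categories (C D : Category) : Prop :=
  exists (F : Functor C D) (G : Functor D C),
    inhabited (NatIso (functor_comp G F) (functor_id C)) /\
    inhabited (NatIso (functor_comp F G) (functor_id D)).

(** Symmetric monoidal categories are not assumed strict: the associator and the
    unitors are explicit, and are inserted wherever a formula would suppress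
    them. *)
Record SymMonCat := {
  smc_cat :> Category;
  tens : Obj smc_cat -> Obj smc_cat -> Obj smc_cat;
  tensh : forall X X' Y Y' : Obj smc_cat,
    Hom X X' -> Hom Y Y' -> Hom (tens X Y) (tens X' Y');
  unit_obj : Obj smc_cat;
  assoc : forall X Y Z, Hom (tens (tens X Y) Z) (tens X (tens Y Z));
  assoc_inv : forall X Y Z, Hom (tens X (tens Y Z)) (tens (tens X Y) Z);
  lunit : forall X, Hom (tens unit_obj X) X;
  lunit_inv : forall X, Hom X (tens unit_obj X);
  runit : forall X, Hom (tens X unit_obj) X;
  runit_inv : forall X, Hom X (tens X unit_obj);
  sym : forall X Y, Hom (tens X Y) (tens Y X);

  tensh_id : forall X Y, tensh 1_X 1_Y = 1_(tens X Y);
  tensh_comp : forall X X' X'' Y Y' Y''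
      (f' : Hom X' X'') (f : Hom X X') (g' : Hom Y' Y'') (g : Hom Y Y'),
    tensh (f' ∘ f) (g' ∘ g) = tensh f' g' ∘ tensh f g;

  assoc_assoc_inv : forall X Y Z,
    assoc X Y Z ∘ assoc_inv X Y Z = 1_(tens X (tens Y Z));
  assoc_inv_assoc : forall X Y Z,
    assoc_inv X Y Z ∘ assoc X Y Z = 1_(tens (tens X Y) Z);
  assoc_natural : forall X X' Y Y' Z Z'
      (f : Hom X X') (g : Hom Y Y') (h : Hom Z Z'),
    assoc X' Y' Z' ∘ tensh (tensh f g) h = tensh f (tensh g h) ∘ assoc X Y Z;

  lunit_lunit_inv : forall X, lunit X ∘ lunit_inv X = 1_X;
  lunit_inv_lunit : forall X, lunit_inv X ∘ lunit X = 1_(tens unit_obj X);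
  lunit_natural : forall X Y (f : Hom X Y),
    lunit Y ∘ tensh 1_unit_obj f = f ∘ lunit X;

  runit_runit_inv : forall X, runit X ∘ runit_inv X = 1_X;
  runit_inv_runit : forall X, runit_inv X ∘ runit X = 1_(tens X unit_obj);
  runit_natural : forall X Y (f : Hom X Y),
    runit Y ∘ tensh f 1_unit_obj = f ∘ runit X;

  pentagon : forall W X Y Z,
    assoc W X (tens Y Z) ∘ assoc (tens W X) Y Z =
    tensh 1_W (assoc X Y Z) ∘ assoc W (tens X Y) Z ∘ tensh (assoc W X Y) 1_Z;
  triangle : forall X Y,
    tensh 1_X (lunit Y) ∘ assoc X unit_obj Y = tensh (runit X) 1_Y;

  sym_natural : forall X X' Y Y' (f : Hom X X') (g : Hom Y Y'),
    sym X' Y' ∘ tensh f g = tensh g f ∘ sym X Y;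
  sym_sym : forall X Y, sym Y X ∘ sym X Y = 1_(tens X Y);
  hexagon : forall X Y Z,
    assoc Y Z X ∘ sym X (tens Y Z) ∘ assoc X Y Z =
    tensh 1_Y (sym X Z) ∘ assoc Y X Z ∘ tensh (sym X Y) 1_Z
}.

Arguments tens {C} X Y : rename.
Arguments tensh {C X X' Y Y'} f g : rename.
Arguments unit_obj {C} : rename.
Arguments assoc {C} X Y Z : rename.
Arguments assoc_inv {C} X Y Z : rename.
Arguments lunit {C} X : rename.
Arguments lunit_inv {C} X : rename.
Arguments runit {C} X : rename.
Arguments runit_inv {C} X : rename.
Arguments sym {C} X Y : rename.

Notation "X ⊗ Y" := (tens X Y) (at level 39, left associativity) : cat_scope.
Notation "f ⊠ g" := (tensh f g) (at level 39, left associativity) : cat_scope.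
Notation "'𝕀'" := unit_obj : cat_scope.

(** [mid_swap W X Y Z] is the morphism usually written [1 ⊗ σ ⊗ 1]. *)
Definition mid_swap {C : SymMonCat} (W X Y Z : Obj C) :
    Hom ((W ⊗ X) ⊗ (Y ⊗ Z)) ((W ⊗ Y) ⊗ (X ⊗ Z)) :=
  assoc_inv W Y (X ⊗ Z)
    ∘ (1_W ⊠ (assoc Y X Z ∘ (sym X Y ⊠ 1_Z) ∘ assoc_inv X Y Z))
    ∘ assoc W X (Y ⊗ Z).

(** Associativity of [mul] is deliberately not required. *)
Record AlgebraOn {C : SymMonCat} (A : Obj C) := {
  mul : Hom (A ⊗ A) A;
  unit : Hom 𝕀 A;
  mul_unitl : mul ∘ (unit ⊠ 1_A) = lunit A;
  mul_unitr : mul ∘ (1_A ⊠ unit) = runit A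
}.

Arguments mul {C A} a : rename.
Arguments unit {C A} a : rename.

Record CoalgebraOn {C : SymMonCat} (A : Obj C) := {
  comul : Hom A (A ⊗ A);
  counit : Hom A 𝕀;
  comul_coassoc : assoc A A A ∘ (comul ⊠ 1_A) ∘ comul = (1_A ⊠ comul) ∘ comul;
  comul_counitl : lunit A ∘ (counit ⊠ 1_A) ∘ comul = 1_A;
  comul_counitr : runit A ∘ (1_A ⊠ counit) ∘ comul = 1_A
}.

Arguments comul {C A} c : rename.
Arguments counit {C A} c : rename.

Definition is_algebra_hom {C : SymMonCat} {A B : Obj C}
    (a : AlgebraOn A) (b : AlgebraOn B) (f : Hom A B) : Prop :=
  f ∘ mul a = mul b ∘ (f ⊠ f) /\ f ∘ unit a = unit b.

Definition is_coalgebra_hom {C : SymMonCat} {A B : Obj C}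
    (a : CoalgebraOn A) (b : CoalgebraOn B) (f : Hom A B) : Prop :=
  comul b ∘ f = (f ⊠ f) ∘ comul a /\ counit b ∘ f = counit a.

Record Bialgebra (C : SymMonCat) := {
  carrier :> Obj C;
  bialg_alg :> AlgebraOn carrier;
  bialg_coalg :> CoalgebraOn carrier;
  comul_mul : comul bialg_coalg ∘ mul bialg_alg =
    (mul bialg_alg ⊠ mul bialg_alg) ∘ mid_swap carrier carrier carrier carrier
      ∘ (comul bialg_coalg ⊠ comul bialg_coalg);
  comul_unit : comul bialg_coalg ∘ unit bialg_alg =
    (unit bialg_alg ⊠ unit bialg_alg) ∘ lunit_inv 𝕀;
  counit_mul : counit bialg_coalg ∘ mul bialg_alg =
    lunit 𝕀 ∘ (counit bialg_coalg ⊠ counit bialg_coalg);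
  counit_unit : counit bialg_coalg ∘ unit bialg_alg = 1_𝕀
}.

Record BialgHom {C : SymMonCat} (A B : Bialgebra C) := {
  bh_map :> Hom A B;
  bh_alg : is_algebra_hom A B bh_map;
  bh_coalg : is_coalgebra_hom A B bh_map
}.

Lemma bialg_hom_eq {C : SymMonCat} (A B : Bialgebra C) (f g : BialgHom A B) :
  bh_map f = bh_map g -> f = g.
Proof.
  destruct f as [f f1 f2], g as [g g1 g2]; simpl; intros ->.
  now rewrite (proof_irrelevance _ f1 g1), (proof_irrelevance _ f2 g2).
Qed.

Definition bialg_id {C : SymMonCat} (A : Bialgebra C) : BialgHom A A.
Proof.
  refine {| bh_map := 1_A |}.
  - split; rewrite ?tensh_id, ?comp_idl, ?comp_idr; reflexivity.
  - split; rewrite ?tensh_id, ?comp_idl, ?comp_idr; reflexivity.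
Defined.

Definition bialg_comp {C : SymMonCat} (X Y Z : Bialgebra C)
  (f : BialgHom Y Z) (g : BialgHom X Y) : BialgHom X Z.
Proof.
  refine {| bh_map := bh_map f ∘ bh_map g |}.
  - destruct f as [f [f1 f2] ?], g as [g [g1 g2] ?]; simpl; split.
    + now rewrite <- comp_assoc, g1, comp_assoc, f1, <- comp_assoc, <- tensh_comp.
    + now rewrite <- comp_assoc, g2, f2.
  - destruct f as [f ? [f1 f2]], g as [g ? [g1 g2]]; simpl; split.
    + now rewrite comp_assoc, f1, <- comp_assoc, g1, comp_assoc, <- tensh_comp.
    + now rewrite comp_assoc, f2, g2.
Defined.

Record Action (C : SymMonCat) := {
  act_B : Bialgebra C;
  act_X : Bialgebra C;
  act : Hom (act_B ⊗ act_X) act_X;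
  act_unitl : act ∘ (unit act_B ⊠ 1_act_X) = lunit act_X;
  act_unitr : act ∘ (1_act_B ⊠ unit act_X) =
    unit act_X ∘ counit act_B ∘ runit act_B;
  act_sym :
    (1_act_B ⊠ act) ∘ assoc act_B act_B act_X ∘ (comul act_B ⊠ 1_act_X) =
    (1_act_B ⊠ act) ∘ assoc act_B act_B act_X
      ∘ (sym act_B act_B ⊠ 1_act_X) ∘ (comul act_B ⊠ 1_act_X);
  act_counit : counit act_X ∘ act = lunit 𝕀 ∘ (counit act_B ⊠ counit act_X);
  act_comul : comul act_X ∘ act =
    (act ⊠ act) ∘ mid_swap act_B act_B act_X act_X
      ∘ (comul act_B ⊠ comul act_X)
}.

Record ActionHom {C : SymMonCat} (S T : Action C) := {
  ah_g : BialgHom (act_B S) (act_B T);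
  ah_v : BialgHom (act_X S) (act_X T);
  ah_act : ah_v ∘ act S = act T ∘ (ah_g ⊠ ah_v)
}.

Lemma action_hom_eq {C : SymMonCat} (S T : Action C) (f f' : ActionHom S T) :
  bh_map (ah_g f) = bh_map (ah_g f') ->
  bh_map (ah_v f) = bh_map (ah_v f') -> f = f'.
Proof.
  destruct f as [g v h], f' as [g' v' h']; simpl; intros Eg Ev.
  apply bialg_hom_eq in Eg; apply bialg_hom_eq in Ev; subst g' v'.
  now rewrite (proof_irrelevance _ h h').
Qed.

Definition action_id {C : SymMonCat} (S : Action C) : ActionHom S S.
Proof.
  refine {| ah_g := bialg_id (act_B S); ah_v := bialg_id (act_X S) |}.
  simpl. now rewrite tensh_id, comp_idl, comp_idr.
Defined.

Definition action_comp {C : SymMonCat} (S T U : Action C)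
  (f : ActionHom T U) (f' : ActionHom S T) : ActionHom S U.
Proof.
  refine {| ah_g := bialg_comp (ah_g f) (ah_g f');
            ah_v := bialg_comp (ah_v f) (ah_v f') |}.
  simpl.
  now rewrite <- comp_assoc, ah_act, comp_assoc, ah_act, <- comp_assoc, <- tensh_comp.
Defined.

Definition Act (C : SymMonCat) : Category.
Proof.
  refine {| Obj := Action C;
            Hom := fun S T => ActionHom S T;
            idm := fun S => action_id S;
            comp := fun S T U f f' => action_comp f f' |}.
  - intros; apply action_hom_eq; apply comp_idl.
  - intros; apply action_hom_eq; apply comp_idr.
  - intros; apply action_hom_eq; apply comp_assoc.
Defined.

(** [sect] is the section usually written [e]; [lambda] is only a morphism of
    [C], not of bialgebras. *)
Record SplitExtension (C : SymMonCat) := {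
  se_X : Bialgebra C;
  se_A : Bialgebra C;
  se_B : Bialgebra C;
  kappa : BialgHom se_X se_A;
  alpha : BialgHom se_A se_B;
  sect : BialgHom se_B se_A;
  lambda : Hom se_A se_X;
  lambda_kappa : lambda ∘ kappa = 1_se_X;
  alpha_sect : alpha ∘ sect = 1_se_B;
  lambda_sect : lambda ∘ sect = unit se_X ∘ counit se_B;
  alpha_kappa : alpha ∘ kappa = unit se_B ∘ counit se_X;
  se_decomp :
    mul se_A ∘ ((kappa ∘ lambda) ⊠ (sect ∘ alpha)) ∘ comul se_A = 1_se_A;
  lambda_mul :
    lambda ∘ mul se_A ∘ (kappa ⊠ sect) = runit se_X ∘ (1_se_X ⊠ counit se_B);
  se_sym :
    (1_se_B ⊠ lambda) ∘ (1_se_B ⊠ mul se_A) ∘ (1_se_B ⊠ (sect ⊠ kappa))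
      ∘ assoc se_B se_B se_X ∘ (comul se_B ⊠ 1_se_X) =
    (1_se_B ⊠ lambda) ∘ (1_se_B ⊠ mul se_A) ∘ (1_se_B ⊠ (sect ⊠ kappa))
      ∘ assoc se_B se_B se_X ∘ (sym se_B se_B ⊠ 1_se_X) ∘ (comul se_B ⊠ 1_se_X);
  se_assoc_kappa_sect_id :
    mul se_A ∘ (mul se_A ⊠ 1_se_A) ∘ ((kappa ⊠ sect) ⊠ 1_se_A) =
    mul se_A ∘ (1_se_A ⊠ mul se_A) ∘ assoc se_A se_A se_A
      ∘ ((kappa ⊠ sect) ⊠ 1_se_A);
  se_assoc_kappa_id_sect :
    mul se_A ∘ (mul se_A ⊠ 1_se_A) ∘ ((kappa ⊠ 1_se_A) ⊠ sect) =
    mul se_A ∘ (1_se_A ⊠ mul se_A) ∘ assoc se_A se_A se_A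
      ∘ ((kappa ⊠ 1_se_A) ⊠ sect);
  se_assoc_id_kappa_sect :
    mul se_A ∘ (mul se_A ⊠ 1_se_A) ∘ ((1_se_A ⊠ kappa) ⊠ sect) =
    mul se_A ∘ (1_se_A ⊠ mul se_A) ∘ assoc se_A se_A se_A
      ∘ ((1_se_A ⊠ kappa) ⊠ sect);
  lambda_coalg : is_coalgebra_hom se_A se_X lambda;
  lambda_unit : lambda ∘ unit se_A = unit se_X
}.

Record SplitExtHom {C : SymMonCat} (S T : SplitExtension C) := {
  sh_g : BialgHom (se_B S) (se_B T);
  sh_v : BialgHom (se_X S) (se_X T);
  sh_p : BialgHom (se_A S) (se_A T);
  sh_kappa : sh_p ∘ kappa S = kappa T ∘ sh_v;
  sh_sect : sh_p ∘ sect S = sect T ∘ sh_g;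
  sh_alpha : alpha T ∘ sh_p = sh_g ∘ alpha S;
  sh_lambda : lambda T ∘ sh_p = sh_v ∘ lambda S
}.

Lemma split_ext_hom_eq {C : SymMonCat} (S T : SplitExtension C)
    (f f' : SplitExtHom S T) :
  bh_map (sh_g f) = bh_map (sh_g f') ->
  bh_map (sh_v f) = bh_map (sh_v f') ->
  bh_map (sh_p f) = bh_map (sh_p f') -> f = f'.
Proof.
  destruct f as [g v p h1 h2 h3 h4], f' as [g' v' p' h1' h2' h3' h4'].
  simpl; intros Eg Ev Ep.
  apply bialg_hom_eq in Eg; apply bialg_hom_eq in Ev; apply bialg_hom_eq in Ep.
  subst g' v' p'.
  now rewrite (proof_irrelevance _ h1 h1'), (proof_irrelevance _ h2 h2'),
    (proof_irrelevance _ h3 h3'), (proof_irrelevance _ h4 h4').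
Qed.

Definition split_ext_id {C : SymMonCat} (S : SplitExtension C) : SplitExtHom S S.
Proof.
  refine {| sh_g := bialg_id (se_B S);
            sh_v := bialg_id (se_X S);
            sh_p := bialg_id (se_A S) |};
  simpl; now rewrite comp_idl, comp_idr.
Defined.

Definition split_ext_comp {C : SymMonCat} (S T U : SplitExtension C)
  (f : SplitExtHom T U) (f' : SplitExtHom S T) : SplitExtHom S U.
Proof.
  refine {| sh_g := bialg_comp (sh_g f) (sh_g f');
            sh_v := bialg_comp (sh_v f) (sh_v f');
            sh_p := bialg_comp (sh_p f) (sh_p f') |}; simpl.
  - now rewrite <- comp_assoc, sh_kappa, comp_assoc, sh_kappa, <- comp_assoc.
  - now rewrite <- comp_assoc, sh_sect, comp_assoc, sh_sect, <- comp_assoc.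
  - now rewrite comp_assoc, sh_alpha, <- comp_assoc, sh_alpha, comp_assoc.
  - now rewrite comp_assoc, sh_lambda, <- comp_assoc, sh_lambda, comp_assoc.
Defined.

Definition SplitExt (C : SymMonCat) : Category.
Proof.
  refine {| Obj := SplitExtension C;
            Hom := fun S T => SplitExtHom S T;
            idm := fun S => split_ext_id S;
            comp := fun S T U f f' => split_ext_comp f f' |}.
  - intros; apply split_ext_hom_eq; apply comp_idl.
  - intros; apply split_ext_hom_eq; apply comp_idr.
  - intros; apply split_ext_hom_eq; apply comp_assoc.
Defined.

(* Main.v *)
Require Import Defs.

(** Coalgebras and their morphisms form a symmetric monoidal category, and a
    bialgebra is a unital magma in it.  For an action [▷] of [B] on [X], the
    cocommutativity axiom says exactly that the coalgebra morphisms [▷] and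
    [b ⊗ x ↦ ε(x) b] cocommute, so that [θ : b ⊗ x ↦ (b_1 ▷ x) ⊗ b_2] is a coalgebra
    morphism [B ⊗ X → X ⊗ B].  Hence [(m ⊗ m) ∘ (1 ⊗ θ ⊗ 1)] makes [X ⊗ B] a bialgebra,
    which is a split extension of [B] by [X].  Conversely a split extension yields the
    action [λ (e b · κ x)]; the morphism [x ⊗ b ↦ κ x · e b] from [X ⊗ B] to [A] is
    inverse to [(λ ⊗ α) ∘ Δ], and it is multiplicative because the decomposition of
    [1_A] gives [e b · κ x = κ (b_1 ▷ x) · e b_2], after which the partial associativity
    axioms suffice to straighten a product. *)

Set Implicit Arguments.
Unset Strict Implicit.
Unset Printing Implicit Defensive.

Local Open Scope cat_scope.

(** * Coherence *)

Section Flattening.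
Variable C : SymMonCat.

Lemma comp_eq2 {X Y Z W : Obj C} {f : Hom Y Z} {g : Hom X Y} {h : Hom X Z}
  (E : f ∘ g = h) (k : Hom Z W) : k ∘ f ∘ g = k ∘ h.
Proof. now rewrite <- comp_assoc, E. Qed.

Lemma tens_id_comp {W X Y Z : Obj C} (f : Hom Y Z) (g : Hom X Y) :
  1_W ⊠ (f ∘ g) = (1_W ⊠ f) ∘ (1_W ⊠ g).
Proof. now rewrite <- tensh_comp, comp_idl. Qed.

Lemma tens_comp_id {W X Y Z : Obj C} (f : Hom Y Z) (g : Hom X Y) :
  (f ∘ g) ⊠ 1_W = (f ⊠ 1_W) ∘ (g ⊠ 1_W).
Proof. now rewrite <- tensh_comp, comp_idl. Qed.

Lemma split_epi_cancel {X Y Z : Obj C} (e : Hom X Y) (s : Hom Y X) (f g : Hom Y Z) :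
  e ∘ s = 1_Y -> f ∘ e = g ∘ e -> f = g.
Proof.
  intros H E. rewrite <- (comp_idr f), <- (comp_idr g), <- H, !comp_assoc.
  now rewrite E.
Qed.

Lemma split_mono_cancel {X Y Z : Obj C} (e : Hom Y Z) (s : Hom Z Y) (f g : Hom X Y) :
  s ∘ e = 1_Y -> e ∘ f = e ∘ g -> f = g.
Proof.
  intros H E. rewrite <- (comp_idl f), <- (comp_idl g), <- H, <- !comp_assoc.
  now rewrite E.
Qed.

Lemma tens_unit_faithful {X Y : Obj C} (f g : Hom X Y) :
  f ⊠ 1_𝕀 = g ⊠ 1_𝕀 -> f = g.
Proof.
  intros E. apply (split_epi_cancel (runit_runit_inv X)).
  now rewrite <- !runit_natural, E.
Qed.

Lemma unit_tens_faithful {X Y : Obj C} (f g : Hom X Y) :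
  1_𝕀 ⊠ f = 1_𝕀 ⊠ g -> f = g.
Proof.
  intros E. apply (split_epi_cancel (lunit_lunit_inv X)).
  now rewrite <- !lunit_natural, E.
Qed.

(** Kelly's argument: this unit triangle is a consequence of [pentagon] and [triangle]. Tensoring
    with [𝕀] on the left is faithful, and after precomposing with an invertible side of the pentagon
    both composites reduce to instances of [triangle]. *)
Lemma lunit_assoc (X Y : Obj C) :
  lunit (X ⊗ Y) ∘ assoc 𝕀 X Y = lunit X ⊠ 1_Y.
Proof.
  apply unit_tens_faithful.
  apply (@split_epi_cancel _ _ _ (assoc 𝕀 (𝕀 ⊗ X) Y ∘ (assoc 𝕀 𝕀 X ⊠ 1_Y))
    ((assoc_inv 𝕀 𝕀 X ⊠ 1_Y) ∘ assoc_inv 𝕀 (𝕀 ⊗ X) Y)).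
  - rewrite !comp_assoc, (comp_eq2 (eq_sym (tens_comp_id _ _))), assoc_assoc_inv,
      tensh_id, comp_idr. apply assoc_assoc_inv.
  - rewrite tens_id_comp, !comp_assoc.
    transitivity ((1_𝕀 ⊠ lunit (X ⊗ Y)) ∘
      (1_𝕀 ⊠ assoc 𝕀 X Y ∘ assoc 𝕀 (𝕀 ⊗ X) Y ∘ (assoc 𝕀 𝕀 X ⊠ 1_Y))).
    { now rewrite !comp_assoc. }
    rewrite <- pentagon, comp_assoc, triangle, <- tensh_id, <- assoc_natural.
    rewrite <- triangle, tens_comp_id, <- assoc_natural.
    now rewrite !comp_assoc.
Qed.

(** Tensor expressions are evaluated as functors [Z ↦ flat a Z], following the
    embedding [X ↦ X ⊗ -] of [C] into its strict monoidal category of endofunctors;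
    this makes all structural isomorphisms disappear. *)
Inductive oexp := OUnit | OAtom (X : Obj C) | OTens (a b : oexp).

Fixpoint ob (a : oexp) : Obj C :=
  match a with
  | OUnit => 𝕀
  | OAtom X => X
  | OTens a b => ob a ⊗ ob b
  end.

Fixpoint flat (a : oexp) (Z : Obj C) : Obj C :=
  match a with
  | OUnit => Z
  | OAtom X => X ⊗ Z
  | OTens a b => flat a (flat b Z)
  end.

Fixpoint whisk (a : oexp) (Z Z' : Obj C) (h : Hom Z Z') : Hom (flat a Z) (flat a Z') :=
  match a with
  | OUnit => h
  | OAtom X => 1_X ⊠ h
  | OTens a b => whisk a (whisk b h)
  end.

Fixpoint flatten (a : oexp) (Z : Obj C) : Hom (ob a ⊗ Z) (flat a Z) :=
  match a with
  | OUnit => lunit Z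
  | OAtom X => 1_(X ⊗ Z)
  | OTens a b => flatten a (flat b Z) ∘ (1_(ob a) ⊠ flatten b Z) ∘ assoc (ob a) (ob b) Z
  end.

Fixpoint unflatten (a : oexp) (Z : Obj C) : Hom (flat a Z) (ob a ⊗ Z) :=
  match a with
  | OUnit => lunit_inv Z
  | OAtom X => 1_(X ⊗ Z)
  | OTens a b =>
      assoc_inv (ob a) (ob b) Z ∘ (1_(ob a) ⊠ unflatten b Z) ∘ unflatten a (flat b Z)
  end.

Lemma flatten_unflatten a Z : flatten a Z ∘ unflatten a Z = 1_(flat a Z).
Proof.
  revert Z; induction a as [|X|a IHa b IHb]; intros Z; simpl;
    rewrite ?lunit_lunit_inv, ?comp_idl; auto.
  rewrite !comp_assoc, (comp_eq2 (assoc_assoc_inv _ _ _)), comp_idr.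
  rewrite (comp_eq2 (eq_sym (tens_id_comp _ _))), IHb, tensh_id, comp_idr.
  apply IHa.
Qed.

Lemma unflatten_flatten a Z : unflatten a Z ∘ flatten a Z = 1_(ob a ⊗ Z).
Proof.
  revert Z; induction a as [|X|a IHa b IHb]; intros Z; simpl;
    rewrite ?lunit_inv_lunit, ?comp_idl; auto.
  rewrite !comp_assoc, (comp_eq2 (IHa _)), comp_idr.
  rewrite (comp_eq2 (eq_sym (tens_id_comp _ _))), IHb, tensh_id, comp_idr.
  apply assoc_inv_assoc.
Qed.

Lemma flatten_natural a Z Z' (h : Hom Z Z') :
  flatten a Z' ∘ (1_(ob a) ⊠ h) = whisk a h ∘ flatten a Z.
Proof.
  revert Z Z' h; induction a as [|X|a IHa b IHb]; intros; simpl.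
  - apply lunit_natural.
  - now rewrite comp_idl, comp_idr.
  - rewrite <- tensh_id, (comp_eq2 (assoc_natural _ _ _)), !comp_assoc.
    rewrite (comp_eq2 (eq_sym (tens_id_comp _ _))), IHb, tens_id_comp, !comp_assoc.
    now rewrite IHa.
Qed.

(** The symmetry has no constructor of its own and enters as an opaque [MGen], so only the monoidal
    coherence is absorbed by evaluation; the symmetry axioms are applied by hand. *)
Inductive mexp : oexp -> oexp -> Type :=
| MId a : mexp a a
| MComp a b c : mexp b c -> mexp a b -> mexp a c
| MTens a a' b b' : mexp a a' -> mexp b b' -> mexp (OTens a b) (OTens a' b')
| MAssoc a b c : mexp (OTens (OTens a b) c) (OTens a (OTens b c))
| MAssocInv a b c : mexp (OTens a (OTens b c)) (OTens (OTens a b) c)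
| MLunit a : mexp (OTens OUnit a) a
| MLunitInv a : mexp a (OTens OUnit a)
| MRunit a : mexp (OTens a OUnit) a
| MRunitInv a : mexp a (OTens a OUnit)
| MGen a b : Hom (ob a) (ob b) -> mexp a b.

Fixpoint den (a b : oexp) (m : mexp a b) : Hom (ob a) (ob b) :=
  match m with
  | MId a => 1_(ob a)
  | MComp f g => den f ∘ den g
  | MTens f g => den f ⊠ den g
  | MAssoc a b c => assoc (ob a) (ob b) (ob c)
  | MAssocInv a b c => assoc_inv (ob a) (ob b) (ob c)
  | MLunit a => lunit (ob a)
  | MLunitInv a => lunit_inv (ob a)
  | MRunit a => runit (ob a)
  | MRunitInv a => runit_inv (ob a)
  | MGen f => f
  end.

Definition gen (a b : oexp) (f : Hom (ob a) (ob b)) (Z : Obj C) :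
    Hom (flat a Z) (flat b Z) :=
  flatten b Z ∘ (f ⊠ 1_Z) ∘ unflatten a Z.

(** The associators and unitors evaluate to identities because their source and
    target have definitionally equal flattenings. *)
Fixpoint eval (a b : oexp) (m : mexp a b) (Z : Obj C) : Hom (flat a Z) (flat b Z) :=
  match m in mexp a b return Hom (flat a Z) (flat b Z) with
  | MId a => 1_(flat a Z)
  | MComp f g => eval f Z ∘ eval g Z
  | @MTens a a' b b' f g => eval f (flat b' Z) ∘ whisk a (eval g Z)
  | MAssoc a b c => 1_(flat a (flat b (flat c Z)))
  | MAssocInv a b c => 1_(flat a (flat b (flat c Z)))
  | MLunit a => 1_(flat a Z)
  | MLunitInv a => 1_(flat a Z)
  | MRunit a => 1_(flat a Z)
  | MRunitInv a => 1_(flat a Z)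
  | MGen f => gen f Z
  end.

(** Soundness of the evaluation: up to the isomorphism [flatten], tensoring [den m] with [Z] is
    [eval m Z]. The associator case is [pentagon], the left unitor is [lunit_assoc], the right
    unitor is [triangle]; for the other morphisms it is naturality or the definition of [gen]. *)
Lemma flatten_den a b (m : mexp a b) Z :
  flatten b Z ∘ (den m ⊠ 1_Z) = eval m Z ∘ flatten a Z.
Proof.
  assert (As : forall a b c Z,
    flatten (OTens a (OTens b c)) Z ∘ (assoc (ob a) (ob b) (ob c) ⊠ 1_Z) =
    flatten (OTens (OTens a b) c) Z).
  { intros a0 b0 c0 Z0; simpl. rewrite !tens_id_comp, !comp_assoc.
    transitivity (flatten a0 (flat b0 (flat c0 Z0)) ∘
      (1_(ob a0) ⊠ flatten b0 (flat c0 Z0)) ∘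
      (1_(ob a0) ⊠ (1_(ob b0) ⊠ flatten c0 Z0)) ∘
      ((1_(ob a0) ⊠ assoc (ob b0) (ob c0) Z0) ∘
         assoc (ob a0) (ob b0 ⊗ ob c0) Z0 ∘ (assoc (ob a0) (ob b0) (ob c0) ⊠ 1_Z0))).
    { now rewrite !comp_assoc. }
    rewrite <- pentagon, !comp_assoc, (comp_eq2 (eq_sym (assoc_natural _ _ _))).
    now rewrite tensh_id, !comp_assoc. }
  assert (Lu : forall a Z,
    flatten a Z ∘ (lunit (ob a) ⊠ 1_Z) = flatten (OTens OUnit a) Z).
  { intros a0 Z0; simpl.
    now rewrite lunit_natural, <- comp_assoc, lunit_assoc. }
  assert (Ru : forall a Z,
    flatten a Z ∘ (runit (ob a) ⊠ 1_Z) = flatten (OTens a OUnit) Z).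
  { intros a0 Z0; simpl. now rewrite <- triangle, comp_assoc. }
  (* The inverse associator and unitors are handled uniformly: the square of an invertible morphism
     yields that of its inverse. *)
  assert (Inv : forall a b (f : Hom (ob a) (ob b)) (g : Hom (ob b) (ob a)) Z
    (p : Hom (flat a Z) (flat b Z)) (q : Hom (flat b Z) (flat a Z)),
    q ∘ p = 1_(flat a Z) -> f ∘ g = 1_(ob b) ->
    flatten b Z ∘ (f ⊠ 1_Z) = p ∘ flatten a Z ->
    flatten a Z ∘ (g ⊠ 1_Z) = q ∘ flatten b Z).
  { intros a0 b0 f g Z0 p q Hqp Hfg E.
    rewrite <- (comp_idl (flatten a0 Z0)), <- Hqp, <- (comp_assoc q), <- E.
    rewrite !comp_assoc, (comp_eq2 (eq_sym (tens_comp_id _ _))), Hfg.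
    now rewrite tensh_id, comp_idr. }
  revert Z; induction m
    as [a|a b c f IHf g IHg|a a' b b' f IHf g IHg|a b c|a b c|a|a|a|a|a b f];
    intros Z; cbn [den eval ob flat whisk].
  - now rewrite tensh_id, comp_idl, comp_idr.
  - now rewrite tens_comp_id, comp_assoc, IHf, <- comp_assoc, IHg, comp_assoc.
  - cbn [flatten ob flat]. rewrite (comp_eq2 (assoc_natural _ _ _)), !comp_assoc.
    rewrite (comp_eq2 (eq_sym (tensh_comp _ _ _ _))), comp_idl, IHg.
    replace (den f ⊠ (eval g Z ∘ flatten b Z))
      with ((den f ⊠ 1_(flat b' Z)) ∘ (1_(ob a) ⊠ (eval g Z ∘ flatten b Z)))
      by now rewrite <- tensh_comp, comp_idl, comp_idr.
    rewrite comp_assoc, IHf, tens_id_comp, !comp_assoc.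
    now rewrite (comp_eq2 (flatten_natural _ _)), !comp_assoc.
  - rewrite comp_idl. apply As.
  - refine (Inv (OTens (OTens a b) c) (OTens a (OTens b c)) _ _ Z
      1_(flat a (flat b (flat c Z))) 1_(flat a (flat b (flat c Z))) _ _ _).
    1: apply comp_idl. 1: apply assoc_assoc_inv.
    rewrite comp_idl. apply As.
  - rewrite comp_idl. apply Lu.
  - refine (Inv (OTens OUnit a) a _ _ Z 1_(flat a Z) 1_(flat a Z) _ _ _).
    1: apply comp_idl. 1: apply lunit_lunit_inv.
    rewrite comp_idl. apply Lu.
  - rewrite comp_idl. apply Ru.
  - refine (Inv (OTens a OUnit) a _ _ Z 1_(flat a Z) 1_(flat a Z) _ _ _).
    1: apply comp_idl. 1: apply runit_runit_inv.
    rewrite comp_idl. apply Ru.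
  - unfold gen. now rewrite <- !comp_assoc, unflatten_flatten, comp_idr.
Qed.

(** The embedding into endofunctors is faithful: evaluations determine [den m ⊠ 1_𝕀] because
    [flatten] is invertible, and tensoring with [𝕀] loses nothing. *)
Lemma eval_inj a b (m n : mexp a b) : (forall Z, eval m Z = eval n Z) -> den m = den n.
Proof.
  intros E. apply tens_unit_faithful.
  apply (split_mono_cancel (unflatten_flatten b 𝕀)).
  now rewrite !flatten_den, E.
Qed.

(** Interchange in flattened form: a generator on the leading strands commutes with whatever acts on
    the tail. *)
Lemma gen_natural a b (f : Hom (ob a) (ob b)) Z Z' (h : Hom Z Z') :
  gen f Z' ∘ whisk a h = whisk b h ∘ gen f Z.
Proof.
  apply (split_epi_cancel (flatten_unflatten a Z)). unfold gen.
  rewrite (comp_eq2 (eq_sym (flatten_natural _ _))), !comp_assoc.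
  rewrite (comp_eq2 (unflatten_flatten _ _)), comp_idr.
  rewrite (comp_eq2 (unflatten_flatten _ _)), comp_idr.
  rewrite <- (flatten_natural b h), (comp_eq2 (eq_sym (tensh_comp _ _ _ _))).
  rewrite (comp_eq2 (eq_sym (tensh_comp _ _ _ _))).
  now rewrite !comp_idl, !comp_idr.
Qed.
End Flattening.

Lemma whisk_swap {C : SymMonCat} {W X Y Y' Z : Obj C}
    {f : Hom Y Z} {g : Hom X Y} {f' : Hom Y' Z} {g' : Hom X Y'}
  (E : f ∘ g = f' ∘ g') :
  (1_W ⊠ f) ∘ (1_W ⊠ g) = (1_W ⊠ f') ∘ (1_W ⊠ g').
Proof. now rewrite <- !tens_id_comp, E. Qed.

(** * Proof by reflection of equations in a monoidal category *)

Ltac reify_ob C X :=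
  lazymatch X with
  | @tens _ ?X1 ?X2 =>
      let a := reify_ob C X1 in let b := reify_ob C X2 in constr:(@OTens C a b)
  | @unit_obj _ => constr:(@OUnit C)
  | _ => constr:(@OAtom C X)
  end.

Ltac reify_hom C f :=
  lazymatch f with
  | @idm _ ?X => let a := reify_ob C X in constr:(@MId C a)
  | @comp _ _ _ _ ?g ?h =>
      let m := reify_hom C g in let n := reify_hom C h in constr:(MComp m n)
  | @tensh _ _ _ _ _ ?g ?h =>
      let m := reify_hom C g in let n := reify_hom C h in constr:(MTens m n)
  | @assoc _ ?X ?Y ?Z =>
      let a := reify_ob C X in let b := reify_ob C Y in let c := reify_ob C Z in
      constr:(@MAssoc C a b c)
  | @assoc_inv _ ?X ?Y ?Z =>
      let a := reify_ob C X in let b := reify_ob C Y in let c := reify_ob C Z in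
      constr:(@MAssocInv C a b c)
  | @lunit _ ?X => let a := reify_ob C X in constr:(@MLunit C a)
  | @lunit_inv _ ?X => let a := reify_ob C X in constr:(@MLunitInv C a)
  | @runit _ ?X => let a := reify_ob C X in constr:(@MRunit C a)
  | @runit_inv _ ?X => let a := reify_ob C X in constr:(@MRunitInv C a)
  | _ =>
      lazymatch type of f with
      | @Hom _ ?X ?Y =>
          let a := reify_ob C X in let b := reify_ob C Y in constr:(@MGen C a b f)
      end
  end.

(** The target form is a left-nested composite of layers, each a single [gen] whiskered by
    identities on its left. *)
Ltac split_layers :=
  repeat first
    [ rewrite comp_idl | rewrite comp_idr | rewrite tensh_id
    | rewrite tens_id_comp | rewrite comp_assoc ].

Ltac flatten_goal :=
  lazymatch goal with
  | |- @eq (@Hom (smc_cat ?C) ?X ?Y) ?f ?g =>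
      let m := reify_hom C f in
      let n := reify_hom C g in
      refine (@eval_inj C _ _ m n _);
      let Z := fresh "Z" in
      intros Z; cbn [eval whisk flat]; split_layers
  end.

(** Failure is meaningful: it occurs when the layer [h] acts on a strand of [a], and then the two
    layers must keep their order. *)
Ltac unwhisk a h :=
  lazymatch a with
  | @OUnit _ => h
  | @OAtom _ ?X => lazymatch h with @tensh _ _ _ _ _ 1_?X ?h' => h' end
  | @OTens _ ?a1 ?a2 => let h' := unwhisk a1 h in unwhisk a2 h'
  end.

Ltac swap_layers f g :=
  lazymatch f with
  | @gen ?C ?a ?b ?f ?Z =>
      let h := unwhisk a g in constr:(@gen_natural C a b f _ _ h)
  | @tensh _ _ _ _ _ (@idm _ ?W) ?f' =>
      lazymatch g with
      | @tensh _ _ _ _ _ (@idm _ W) ?g' =>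
          let E := swap_layers f' g' in constr:(whisk_swap (W := W) E)
      end
  end.

(** Interchange is oriented so that a layer further to the left acts first. *)
Ltac sort_layers :=
  repeat match goal with
  | |- context [?f ∘ ?g] =>
      let f' := lazymatch f with _ ∘ ?f' => f' | _ => f end in
      let E := swap_layers f' g in
      let T := type of E in
      let T' := eval cbn [whisk flat] in T in
      first [ rewrite (comp_eq2 (E : T')) | rewrite (E : T') ];
      split_layers
  end.

(** Closes equations that hold by coherence of associators and unitors together with interchange,
    all other morphisms being opaque. *)
Ltac monoidal := flatten_goal; sort_layers; reflexivity.

(** * The symmetry *)

Section Symmetry.
Context {C : SymMonCat}.

(** Not an axiom of [SymMonCat]: it follows from [hexagon] at [X], [𝕀], [𝕀] and naturality of the
    symmetry along [lunit 𝕀], after tensoring with [𝕀] and cancelling an invertible symmetry. *)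
Lemma lunit_sym (X : Obj C) : lunit X ∘ sym X 𝕀 = runit X.
Proof.
  apply tens_unit_faithful.
  apply (split_mono_cancel (sym_sym X 𝕀)).
  transitivity (lunit (𝕀 ⊗ X) ∘
    ((1_𝕀 ⊠ sym X 𝕀) ∘ assoc 𝕀 X 𝕀 ∘ (sym X 𝕀 ⊠ 1_𝕀))).
  { monoidal. }
  rewrite <- hexagon.
  transitivity ((lunit 𝕀 ⊠ 1_X) ∘ sym X (𝕀 ⊗ 𝕀) ∘ assoc X 𝕀 𝕀).
  { monoidal. }
  rewrite <- sym_natural. monoidal.
Qed.

Lemma sym_unit_r (X : Obj C) : sym X 𝕀 = lunit_inv X ∘ runit X.
Proof. now rewrite <- lunit_sym, comp_assoc, lunit_inv_lunit, comp_idl. Qed.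

Lemma sym_unit_l (X : Obj C) : sym 𝕀 X = runit_inv X ∘ lunit X.
Proof.
  apply (split_mono_cancel (sym_sym X 𝕀)).
  rewrite sym_sym, sym_unit_r. monoidal.
Qed.

Lemma sym_tens_r (X Y Z : Obj C) :
  sym X (Y ⊗ Z) =
  assoc_inv Y Z X ∘ (1_Y ⊠ sym X Z) ∘ assoc Y X Z ∘ (sym X Y ⊠ 1_Z) ∘ assoc_inv X Y Z.
Proof.
  transitivity (assoc_inv Y Z X ∘
    (assoc Y Z X ∘ sym X (Y ⊗ Z) ∘ assoc X Y Z) ∘ assoc_inv X Y Z).
  { monoidal. }
  now rewrite hexagon, !comp_assoc.
Qed.

(** The second hexagon, obtained from the first by inverting every symmetry with [sym_sym]. *)
Lemma sym_tens_l (X Y Z : Obj C) :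
  sym (X ⊗ Y) Z =
  assoc Z X Y ∘ (sym X Z ⊠ 1_Y) ∘ assoc_inv X Z Y ∘ (1_X ⊠ sym Y Z) ∘ assoc X Y Z.
Proof.
  apply (split_mono_cancel (sym_sym Z (X ⊗ Y))).
  rewrite sym_sym, sym_tens_r. symmetry.
  transitivity (assoc_inv X Y Z ∘ (1_X ⊠ sym Z Y) ∘ assoc X Z Y
    ∘ ((sym Z X ∘ sym X Z) ⊠ 1_Y) ∘ assoc_inv X Z Y ∘ (1_X ⊠ sym Y Z) ∘ assoc X Y Z).
  { monoidal. }
  rewrite sym_sym.
  transitivity (assoc_inv X Y Z ∘ (1_X ⊠ (sym Z Y ∘ sym Y Z)) ∘ assoc X Y Z).
  { monoidal. }
  rewrite sym_sym. monoidal.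
Qed.

(** Generalises [mid_swap], which is the case [t := sym X Y]; taking the twist [theta] of an action
    instead gives the multiplication of the smash product. *)
Definition mid {W X X' Y Y' Z : Obj C} (t : Hom (X ⊗ Y) (Y' ⊗ X')) :
    Hom ((W ⊗ X) ⊗ (Y ⊗ Z)) ((W ⊗ Y') ⊗ (X' ⊗ Z)) :=
  assoc_inv W Y' (X' ⊗ Z) ∘ (1_W ⊠ (assoc Y' X' Z ∘ (t ⊠ 1_Z) ∘ assoc_inv X Y Z))
    ∘ assoc W X (Y ⊗ Z).

Lemma mid_natural {W W' X1 X2 X3 X4 Y1 Y2 Y3 Y4 Z Z' : Obj C}
    {t : Hom (X2 ⊗ Y2) (Y4 ⊗ X4)} {t' : Hom (X1 ⊗ Y1) (Y3 ⊗ X3)}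
    {g : Hom X1 X2} {h : Hom Y1 Y2} {g' : Hom X3 X4} {h' : Hom Y3 Y4}
    (f : Hom W W') (k : Hom Z Z') :
  t ∘ (g ⊠ h) = (h' ⊠ g') ∘ t' ->
  mid t ∘ ((f ⊠ g) ⊠ (h ⊠ k)) = ((f ⊠ h') ⊠ (g' ⊠ k)) ∘ mid t'.
Proof.
  intros E. unfold mid.
  transitivity (assoc_inv W' Y4 (X4 ⊗ Z')
    ∘ (f ⊠ (assoc Y4 X4 Z' ∘ ((t ∘ (g ⊠ h)) ⊠ k) ∘ assoc_inv X1 Y1 Z))
    ∘ assoc W X1 (Y1 ⊗ Z)).
  { monoidal. }
  rewrite E. monoidal.
Qed.

Lemma mid_swap_natural {W W' X X' Y Y' Z Z' : Obj C}
    (f : Hom W W') (g : Hom X X') (h : Hom Y Y') (k : Hom Z Z') :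
  mid_swap W' X' Y' Z' ∘ ((f ⊠ g) ⊠ (h ⊠ k)) =
  ((f ⊠ h) ⊠ (g ⊠ k)) ∘ mid_swap W X Y Z.
Proof. apply (mid_natural f k (sym_natural g h)). Qed.

(** Both sides are the same shuffle of six factors, by the two hexagons. This yields coassociativity
    of a tensor product of coalgebras. *)
Lemma mid_swap_assoc (X Y Z X' Y' Z' : Obj C) :
  assoc (X ⊗ X') (Y ⊗ Y') (Z ⊗ Z') ∘ (mid_swap X Y X' Y' ⊠ 1_(Z ⊗ Z'))
    ∘ mid_swap (X ⊗ Y) Z (X' ⊗ Y') Z' =
  (1_(X ⊗ X') ⊠ mid_swap Y Z Y' Z') ∘ mid_swap X (Y ⊗ Z) X' (Y' ⊗ Z')
    ∘ (assoc X Y Z ⊠ assoc X' Y' Z').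
Proof. unfold mid_swap. rewrite sym_tens_l, sym_tens_r. monoidal. Qed.

(** The companion shuffle identity, which makes the associator a morphism of coalgebras. *)
Lemma assoc_mid_swap (X Y Z X' Y' Z' : Obj C) :
  (assoc X Y Z ⊠ assoc X' Y' Z') ∘ mid_swap (X ⊗ Y) (X' ⊗ Y') Z Z'
    ∘ (mid_swap X X' Y Y' ⊠ 1_(Z ⊗ Z')) =
  mid_swap X X' (Y ⊗ Z) (Y' ⊗ Z') ∘ (1_(X ⊗ X') ⊠ mid_swap Y Y' Z Z')
    ∘ assoc (X ⊗ X') (Y ⊗ Y') (Z ⊗ Z').
Proof. unfold mid_swap. rewrite sym_tens_l, sym_tens_r. monoidal. Qed.

Lemma mid_swap_unit_3 (X X' Y : Obj C) :
  (runit X ⊠ 1_(X' ⊗ Y)) ∘ mid_swap X X' 𝕀 Y =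
  assoc X X' Y ∘ (1_(X ⊗ X') ⊠ lunit Y).
Proof. unfold mid_swap. rewrite sym_unit_r. monoidal. Qed.

Lemma mid_swap_unit_4 (X X' Y : Obj C) :
  (1_(X ⊗ Y) ⊠ runit X') ∘ mid_swap X X' Y 𝕀 =
  assoc_inv X Y X' ∘ (1_X ⊠ sym X' Y) ∘ assoc X X' Y ∘ (1_(X ⊗ X') ⊠ runit Y).
Proof.
  unfold mid_swap.
  transitivity ((1_(X ⊗ Y) ⊠ runit X') ∘ (assoc_inv X Y (X' ⊗ 𝕀)
    ∘ (1_X ⊠ (assoc Y X' 𝕀 ∘ runit_inv (Y ⊗ X')
        ∘ (runit (Y ⊗ X') ∘ (sym X' Y ⊠ 1_𝕀)) ∘ assoc_inv X' Y 𝕀))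
    ∘ assoc X X' (Y ⊗ 𝕀))).
  { monoidal. }
  rewrite runit_natural. monoidal.
Qed.

End Symmetry.

(** * Tensor products of coalgebras *)

Section Coalgebras.
Context {C : SymMonCat}.

Definition coalg_unit : CoalgebraOn (@unit_obj C).
Proof. refine {| comul := lunit_inv 𝕀; counit := 1_𝕀 |}; monoidal. Defined.

(** Naturality of [mid_swap] moves comultiplications and counits past the interchange; each axiom
    then splits into the corresponding axioms of the two factors. *)
Definition coalg_tens {X Y : Obj C} (a : CoalgebraOn X) (b : CoalgebraOn Y) :
    CoalgebraOn (X ⊗ Y).
Proof.
  refine {| comul := mid_swap X X Y Y ∘ (comul a ⊠ comul b);
            counit := lunit 𝕀 ∘ (counit a ⊠ counit b) |}.
  - transitivity (assoc (X ⊗ Y) (X ⊗ Y) (X ⊗ Y) ∘ (mid_swap X X Y Y ⊠ 1_(X ⊗ Y))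
      ∘ (((comul a ⊠ comul b) ⊠ (1_X ⊠ 1_Y)) ∘ mid_swap X X Y Y) ∘ (comul a ⊠ comul b)).
    { monoidal. }
    rewrite <- mid_swap_natural.
    transitivity (assoc (X ⊗ Y) (X ⊗ Y) (X ⊗ Y) ∘ (mid_swap X X Y Y ⊠ 1_(X ⊗ Y))
      ∘ mid_swap (X ⊗ X) X (Y ⊗ Y) Y
      ∘ (((comul a ⊠ 1_X) ∘ comul a) ⊠ ((comul b ⊠ 1_Y) ∘ comul b))).
    { monoidal. }
    rewrite mid_swap_assoc.
    transitivity ((1_(X ⊗ Y) ⊠ mid_swap X X Y Y) ∘ mid_swap X (X ⊗ X) Y (Y ⊗ Y)
      ∘ ((assoc X X X ∘ (comul a ⊠ 1_X) ∘ comul a) ⊠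
         (assoc Y Y Y ∘ (comul b ⊠ 1_Y) ∘ comul b))).
    { monoidal. }
    rewrite !comul_coassoc.
    transitivity ((1_(X ⊗ Y) ⊠ mid_swap X X Y Y) ∘
      (mid_swap X (X ⊗ X) Y (Y ⊗ Y) ∘ ((1_X ⊠ comul a) ⊠ (1_Y ⊠ comul b)))
      ∘ (comul a ⊠ comul b)).
    { monoidal. }
    rewrite mid_swap_natural. monoidal.
  - transitivity (lunit (X ⊗ Y) ∘ (lunit 𝕀 ⊠ 1_(X ⊗ Y))
      ∘ (((counit a ⊠ counit b) ⊠ (1_X ⊠ 1_Y)) ∘ mid_swap X X Y Y) ∘ (comul a ⊠ comul b)).
    { monoidal. }
    rewrite <- mid_swap_natural.
    transitivity (lunit (X ⊗ Y) ∘ ((runit 𝕀 ⊠ 1_(X ⊗ Y)) ∘ mid_swap 𝕀 X 𝕀 Y)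
      ∘ (((counit a ⊠ 1_X) ∘ comul a) ⊠ ((counit b ⊠ 1_Y) ∘ comul b))).
    { monoidal. }
    rewrite mid_swap_unit_3.
    transitivity ((lunit X ∘ (counit a ⊠ 1_X) ∘ comul a) ⊠
      (lunit Y ∘ (counit b ⊠ 1_Y) ∘ comul b)).
    { monoidal. }
    now rewrite !comul_counitl, tensh_id.
  - transitivity (runit (X ⊗ Y) ∘ (1_(X ⊗ Y) ⊠ lunit 𝕀)
      ∘ (((1_X ⊠ 1_Y) ⊠ (counit a ⊠ counit b)) ∘ mid_swap X X Y Y) ∘ (comul a ⊠ comul b)).
    { monoidal. }
    rewrite <- mid_swap_natural.
    transitivity (runit (X ⊗ Y) ∘ ((1_(X ⊗ Y) ⊠ runit 𝕀) ∘ mid_swap X 𝕀 Y 𝕀)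
      ∘ (((1_X ⊠ counit a) ∘ comul a) ⊠ ((1_Y ⊠ counit b) ∘ comul b))).
    { monoidal. }
    rewrite mid_swap_unit_4, sym_unit_l.
    transitivity ((runit X ∘ (1_X ⊠ counit a) ∘ comul a) ⊠
      (runit Y ∘ (1_Y ⊠ counit b) ∘ comul b)).
    { monoidal. }
    now rewrite !comul_counitr, tensh_id.
Defined.

(** * Morphisms of coalgebras: closure properties and structural isomorphisms *)

Lemma coalgebra_hom_id {X : Obj C} (a : CoalgebraOn X) : is_coalgebra_hom a a 1_X.
Proof. split; now rewrite ?tensh_id, ?comp_idl, ?comp_idr. Qed.

Lemma coalgebra_hom_comp {X Y Z : Obj C}
    {a : CoalgebraOn X} {b : CoalgebraOn Y} {c : CoalgebraOn Z}
    {f : Hom Y Z} {g : Hom X Y} :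
  is_coalgebra_hom b c f -> is_coalgebra_hom a b g -> is_coalgebra_hom a c (f ∘ g).
Proof.
  intros [f1 f2] [g1 g2]; split.
  - now rewrite comp_assoc, f1, <- comp_assoc, g1, comp_assoc, <- tensh_comp.
  - now rewrite comp_assoc, f2.
Qed.

Lemma coalgebra_hom_inv {X Y : Obj C} {a : CoalgebraOn X} {b : CoalgebraOn Y}
    {f : Hom X Y} {g : Hom Y X} :
  f ∘ g = 1_Y -> g ∘ f = 1_X -> is_coalgebra_hom a b f -> is_coalgebra_hom b a g.
Proof.
  intros Hfg Hgf [f1 f2]; split.
  - apply (split_epi_cancel Hfg).
    now rewrite <- !comp_assoc, f1, Hgf, comp_idr, comp_assoc, <- tensh_comp, Hgf,
      tensh_id, comp_idl.
  - apply (split_epi_cancel Hfg).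
    now rewrite f2, <- comp_assoc, Hgf, comp_idr.
Qed.

Lemma coalgebra_hom_tens {X X' Y Y' : Obj C}
    {a : CoalgebraOn X} {a' : CoalgebraOn X'} {b : CoalgebraOn Y} {b' : CoalgebraOn Y'}
    {f : Hom X X'} {g : Hom Y Y'} :
  is_coalgebra_hom a a' f -> is_coalgebra_hom b b' g ->
  is_coalgebra_hom (coalg_tens a b) (coalg_tens a' b') (f ⊠ g).
Proof.
  intros [f1 f2] [g1 g2]; split; cbn [comul counit coalg_tens].
  - rewrite <- comp_assoc, <- tensh_comp, f1, g1, tensh_comp, comp_assoc.
    now rewrite mid_swap_natural, comp_assoc.
  - now rewrite <- comp_assoc, <- tensh_comp, f2, g2.
Qed.

Lemma coalgebra_hom_assoc {X Y Z : Obj C}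
    (a : CoalgebraOn X) (b : CoalgebraOn Y) (c : CoalgebraOn Z) :
  is_coalgebra_hom (coalg_tens (coalg_tens a b) c) (coalg_tens a (coalg_tens b c))
    (assoc X Y Z).
Proof.
  split; cbn [comul counit coalg_tens].
  - transitivity (mid_swap X X (Y ⊗ Z) (Y ⊗ Z) ∘ (1_(X ⊗ X) ⊠ mid_swap Y Y Z Z)
      ∘ assoc (X ⊗ X) (Y ⊗ Y) (Z ⊗ Z) ∘ ((comul a ⊠ comul b) ⊠ comul c)).
    { monoidal. }
    rewrite <- assoc_mid_swap. monoidal.
  - monoidal.
Qed.

Lemma coalgebra_hom_assoc_inv {X Y Z : Obj C}
    (a : CoalgebraOn X) (b : CoalgebraOn Y) (c : CoalgebraOn Z) :
  is_coalgebra_hom (coalg_tens a (coalg_tens b c)) (coalg_tens (coalg_tens a b) c)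
    (assoc_inv X Y Z).
Proof.
  apply (coalgebra_hom_inv (assoc_assoc_inv X Y Z) (assoc_inv_assoc X Y Z)).
  apply coalgebra_hom_assoc.
Qed.

Lemma coalgebra_hom_lunit {X : Obj C} (a : CoalgebraOn X) :
  is_coalgebra_hom (coalg_tens coalg_unit a) a (lunit X).
Proof.
  split; cbn [comul counit coalg_tens coalg_unit].
  - unfold mid_swap. rewrite sym_unit_l. monoidal.
  - monoidal.
Qed.

Lemma coalgebra_hom_runit {X : Obj C} (a : CoalgebraOn X) :
  is_coalgebra_hom (coalg_tens a coalg_unit) a (runit X).
Proof.
  split; cbn [comul counit coalg_tens coalg_unit].
  - unfold mid_swap. rewrite sym_unit_r. monoidal.
  - monoidal.
Qed.

Lemma coalgebra_hom_lunit_inv {X : Obj C} (a : CoalgebraOn X) :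
  is_coalgebra_hom a (coalg_tens coalg_unit a) (lunit_inv X).
Proof.
  apply (coalgebra_hom_inv (lunit_lunit_inv X) (lunit_inv_lunit X)).
  apply coalgebra_hom_lunit.
Qed.

Lemma coalgebra_hom_runit_inv {X : Obj C} (a : CoalgebraOn X) :
  is_coalgebra_hom a (coalg_tens a coalg_unit) (runit_inv X).
Proof.
  apply (coalgebra_hom_inv (runit_runit_inv X) (runit_inv_runit X)).
  apply coalgebra_hom_runit.
Qed.

Lemma coalgebra_hom_counit {X : Obj C} (a : CoalgebraOn X) :
  is_coalgebra_hom a coalg_unit (counit a).
Proof.
  split; cbn [comul counit coalg_unit].
  (* Inserting the counit law turns [ε] into [(ε ⊗ ε) ∘ Δ]. *)
  - transitivity (lunit_inv 𝕀 ∘ counit a ∘ (lunit X ∘ (counit a ⊠ 1_X) ∘ comul a)).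
    { now rewrite comul_counitl, comp_idr. }
    monoidal.
  - apply comp_idl.
Qed.

(** A pair of coalgebra morphisms out of [D] induces a coalgebra morphism into the
    tensor product exactly when their images cocommute. *)
Lemma coalgebra_hom_pair {D X Y : Obj C}
    {d : CoalgebraOn D} {a : CoalgebraOn X} {b : CoalgebraOn Y}
    {f : Hom D X} {g : Hom D Y} :
  is_coalgebra_hom d a f -> is_coalgebra_hom d b g ->
  (g ⊠ f) ∘ comul d = sym X Y ∘ (f ⊠ g) ∘ comul d ->
  is_coalgebra_hom d (coalg_tens a b) ((f ⊠ g) ∘ comul d).
Proof.
  intros [f1 f2] [g1 g2] E; split; cbn [comul counit coalg_tens].
  - transitivity (mid_swap X X Y Y ∘ ((comul a ∘ f) ⊠ (comul b ∘ g)) ∘ comul d).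
    { monoidal. }
    rewrite f1, g1.
    (* Coassociativity rebrackets [d_1 ⊗ d_2 ⊗ d_3 ⊗ d_4] so that the two middle factors, which the
       interchange exchanges, come from a single [comul d]. *)
    transitivity (mid_swap X X Y Y ∘ ((f ⊠ f) ⊠ (g ⊠ g))
      ∘ assoc (D ⊗ D) D D ∘ (assoc_inv D D D ⊠ 1_D) ∘ ((1_D ⊠ comul d) ⊠ 1_D)
      ∘ (comul d ⊠ 1_D) ∘ comul d).
    { transitivity (mid_swap X X Y Y ∘ ((f ⊠ f) ⊠ (g ⊠ g))
        ∘ assoc (D ⊗ D) D D ∘ ((comul d ⊠ 1_D) ⊠ 1_D) ∘ assoc_inv D D D
        ∘ ((1_D ⊠ comul d) ∘ comul d)).
      { monoidal. }
      rewrite <- comul_coassoc.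
      transitivity (mid_swap X X Y Y ∘ ((f ⊠ f) ⊠ (g ⊠ g))
        ∘ assoc (D ⊗ D) D D ∘ (assoc_inv D D D ⊠ 1_D)
        ∘ ((assoc D D D ∘ (comul d ⊠ 1_D) ∘ comul d) ⊠ 1_D) ∘ comul d).
      { monoidal. }
      rewrite comul_coassoc. monoidal. }
    (* The middle is now the right-hand side of [E], whose use removes the symmetry; coassociativity
       then restores the original bracketing. *)
    transitivity (assoc_inv X Y (X ⊗ Y) ∘ (1_X ⊠ assoc Y X Y) ∘ assoc X (Y ⊗ X) Y
      ∘ ((f ⊠ (sym X Y ∘ (f ⊠ g) ∘ comul d)) ⊠ g)
      ∘ (comul d ⊠ 1_D) ∘ comul d).
    { unfold mid_swap. monoidal. }
    rewrite <- E.
    transitivity ((f ⊠ g ⊠ (f ⊠ g)) ∘ assoc_inv D D (D ⊗ D) ∘ (1_D ⊠ assoc D D D)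
      ∘ (1_D ⊠ (comul d ⊠ 1_D)) ∘ (assoc D D D ∘ (comul d ⊠ 1_D) ∘ comul d)).
    { monoidal. }
    rewrite comul_coassoc.
    transitivity ((f ⊠ g ⊠ (f ⊠ g)) ∘ assoc_inv D D (D ⊗ D)
      ∘ (1_D ⊠ (assoc D D D ∘ (comul d ⊠ 1_D) ∘ comul d)) ∘ comul d).
    { monoidal. }
    rewrite comul_coassoc.
    transitivity ((f ⊠ g ⊠ ((f ⊠ g) ∘ comul d)) ∘ assoc_inv D D D
      ∘ ((1_D ⊠ comul d) ∘ comul d)).
    { monoidal. }
    rewrite <- comul_coassoc. monoidal.
  - transitivity (lunit 𝕀 ∘ ((counit a ∘ f) ⊠ (counit b ∘ g)) ∘ comul d).
    { monoidal. }
    rewrite f2, g2.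
    transitivity (counit d ∘ (lunit D ∘ (counit d ⊠ 1_D) ∘ comul d)).
    { monoidal. }
    now rewrite comul_counitl, comp_idr.
Qed.

Lemma coalgebra_hom_mul (A : Bialgebra C) :
  is_coalgebra_hom (coalg_tens A A) A (mul A).
Proof.
  split; cbn [comul counit coalg_tens]; rewrite ?comp_assoc;
    auto using comul_mul, counit_mul.
Qed.

Lemma coalgebra_hom_unit (A : Bialgebra C) : is_coalgebra_hom coalg_unit A (unit A).
Proof. split; [apply comul_unit | apply counit_unit]. Qed.

Lemma coalgebra_hom_act (S : Action C) :
  is_coalgebra_hom (coalg_tens (act_B S) (act_X S)) (act_X S) (act S).
Proof.
  split; cbn [comul counit coalg_tens]; rewrite ?comp_assoc;
    auto using act_comul, act_counit.
Qed.

End Coalgebras.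

(** * The smash product of an action *)

Section Smash.
Context {C : SymMonCat}.
Variable S : Action C.
Local Notation B := (act_B S).
Local Notation X := (act_X S).
Local Notation D := (coalg_tens B X).

Definition act_proj : Hom (B ⊗ X) B := runit B ∘ (1_B ⊠ counit X).

(** In Sweedler notation, [b ⊗ x ↦ (b_1 ▷ x) ⊗ b_2]. *)
Definition theta : Hom (B ⊗ X) (X ⊗ B) := (act S ⊠ act_proj) ∘ comul D.

Lemma coalgebra_hom_act_proj : is_coalgebra_hom D B act_proj.
Proof.
  refine (coalgebra_hom_comp (coalgebra_hom_runit B) _).
  apply coalgebra_hom_tens; auto using coalgebra_hom_id, coalgebra_hom_counit.
Qed.

(** Since [ε(x_1) x_2 = x], both sides are [b_1 ⊗ (b_2 ▷ x)]. This identifies one side of the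
    cocommutation condition with the left-hand side of [act_sym]. *)
Lemma act_proj_act_comul :
  (act_proj ⊠ act S) ∘ comul D = (1_B ⊠ act S) ∘ assoc B B X ∘ (comul B ⊠ 1_X).
Proof.
  cbn [comul coalg_tens]. unfold act_proj.
  transitivity ((runit B ⊠ act S)
    ∘ (((1_B ⊠ counit X) ⊠ (1_B ⊠ 1_X)) ∘ mid_swap B B X X) ∘ (comul B ⊠ comul X)).
  { monoidal. }
  rewrite <- mid_swap_natural.
  transitivity ((1_B ⊠ act S) ∘ ((runit B ⊠ 1_(B ⊗ X)) ∘ mid_swap B B 𝕀 X)
    ∘ (comul B ⊠ ((counit X ⊠ 1_X) ∘ comul X))).
  { monoidal. }
  rewrite mid_swap_unit_3.
  transitivity ((1_B ⊠ act S) ∘ assoc B B X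
    ∘ (comul B ⊠ (lunit X ∘ (counit X ⊠ 1_X) ∘ comul X))).
  { monoidal. }
  now rewrite comul_counitl.
Qed.

Lemma theta_eq :
  theta = (act S ⊠ 1_B) ∘ assoc_inv B X B ∘ (1_B ⊠ sym B X) ∘ assoc B B X
    ∘ (comul B ⊠ 1_X).
Proof.
  unfold theta, act_proj. cbn [comul coalg_tens].
  transitivity ((act S ⊠ runit B)
    ∘ (((1_B ⊠ 1_X) ⊠ (1_B ⊠ counit X)) ∘ mid_swap B B X X) ∘ (comul B ⊠ comul X)).
  { monoidal. }
  rewrite <- mid_swap_natural.
  transitivity ((act S ⊠ 1_B) ∘ ((1_(B ⊗ X) ⊠ runit B) ∘ mid_swap B B X 𝕀)
    ∘ (comul B ⊠ ((1_X ⊠ counit X) ∘ comul X))).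
  { monoidal. }
  rewrite mid_swap_unit_4.
  transitivity ((act S ⊠ 1_B) ∘ assoc_inv B X B ∘ (1_B ⊠ sym B X) ∘ assoc B B X
    ∘ (comul B ⊠ (runit X ∘ (1_X ⊠ counit X) ∘ comul X))).
  { monoidal. }
  now rewrite comul_counitr.
Qed.

(** By [act_sym], [b_1 ⊗ (b_2 ▷ x)] equals [b_2 ⊗ (b_1 ▷ x)], which is [theta] followed by the
    symmetry; this is the hypothesis of [coalgebra_hom_pair]. *)
Lemma coalgebra_hom_theta : is_coalgebra_hom D (coalg_tens X B) theta.
Proof.
  apply (coalgebra_hom_pair (coalgebra_hom_act S) coalgebra_hom_act_proj).
  rewrite act_proj_act_comul, act_sym.
  rewrite <- (comp_assoc (sym X B)). fold theta.
  rewrite theta_eq, !comp_assoc, sym_natural.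
  rewrite sym_tens_l. symmetry.
  transitivity ((1_B ⊠ act S) ∘ assoc B B X ∘ (sym B B ⊠ 1_X) ∘ assoc_inv B B X
    ∘ (1_B ⊠ (sym X B ∘ sym B X)) ∘ assoc B B X ∘ (comul B ⊠ 1_X)).
  { monoidal. }
  rewrite sym_sym. monoidal.
Qed.

(** Moves the comultiplication inside [theta] back to the source, so that unit laws, or
    compatibility with a morphism of actions, can be applied to each component separately. *)
Lemma comul_tens_comp {Y Z : Obj C} {a : CoalgebraOn Y} {b : CoalgebraOn Z}
  {f : Hom Y B} {g : Hom Z X} :
  is_coalgebra_hom a B f -> is_coalgebra_hom b X g ->
  theta ∘ (f ⊠ g) =
  ((act S ∘ (f ⊠ g)) ⊠ (act_proj ∘ (f ⊠ g))) ∘ comul (coalg_tens a b).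
Proof.
  intros Hf Hg. unfold theta.
  rewrite <- comp_assoc, (proj1 (coalgebra_hom_tens Hf Hg)), comp_assoc.
  now rewrite <- tensh_comp.
Qed.

Lemma theta_unit_l : theta ∘ (unit B ⊠ 1_X) = (1_X ⊠ unit B) ∘ runit_inv X ∘ lunit X.
Proof.
  rewrite (comul_tens_comp (coalgebra_hom_unit B) (coalgebra_hom_id X)), act_unitl.
  unfold act_proj.
  transitivity ((lunit X ⊠ unit B) ∘ runit_inv (𝕀 ⊗ X)
    ∘ (runit (𝕀 ⊗ X) ∘ (1_(𝕀 ⊗ X) ⊠ counit (coalg_tens coalg_unit X))
    ∘ comul (coalg_tens coalg_unit X))).
  { cbn [counit coalg_tens coalg_unit]. monoidal. }
  rewrite comul_counitr. monoidal.
Qed.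

Lemma theta_unit_r : theta ∘ (1_B ⊠ unit X) = (unit X ⊠ 1_B) ∘ lunit_inv B ∘ runit B.
Proof.
  rewrite (comul_tens_comp (coalgebra_hom_id B) (coalgebra_hom_unit X)), act_unitr.
  transitivity ((unit X ⊠ (runit B ∘ (1_B ⊠ (counit X ∘ unit X)))) ∘ lunit_inv (B ⊗ 𝕀)
    ∘ (lunit (B ⊗ 𝕀) ∘ (counit (coalg_tens B coalg_unit) ⊠ 1_(B ⊗ 𝕀))
    ∘ comul (coalg_tens B coalg_unit))).
  { unfold act_proj. cbn [counit coalg_tens coalg_unit]. monoidal. }
  rewrite comul_counitl, counit_unit. monoidal.
Qed.

(** The counit law in [B ⊗ X]; it lets the action be read off from the smash product. *)
Lemma theta_counit_r : runit X ∘ (1_X ⊠ counit B) ∘ theta = act S.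
Proof.
  unfold theta.
  transitivity (runit X ∘ (act S ⊠ (counit B ∘ act_proj)) ∘ comul D).
  { monoidal. }
  rewrite (proj2 coalgebra_hom_act_proj).
  transitivity (act S ∘ (runit (B ⊗ X) ∘ (1_(B ⊗ X) ⊠ counit D) ∘ comul D)).
  { monoidal. }
  now rewrite comul_counitr, comp_idr.
Qed.

Lemma theta_counit_l : lunit B ∘ (counit X ⊠ 1_B) ∘ theta = act_proj.
Proof.
  unfold theta.
  transitivity (lunit B ∘ ((counit X ∘ act S) ⊠ act_proj) ∘ comul D).
  { monoidal. }
  rewrite (proj2 (coalgebra_hom_act S)).
  transitivity (act_proj ∘ (lunit (B ⊗ X) ∘ (counit D ⊠ 1_(B ⊗ X)) ∘ comul D)).
  { monoidal. }
  now rewrite comul_counitl, comp_idr.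
Qed.

(** * The bialgebra structure on [X ⊗ B] *)

Definition inj_X : Hom X (X ⊗ B) := (1_X ⊠ unit B) ∘ runit_inv X.
Definition inj_B : Hom B (X ⊗ B) := (unit X ⊠ 1_B) ∘ lunit_inv B.
Definition proj_X : Hom (X ⊗ B) X := runit X ∘ (1_X ⊠ counit B).
Definition proj_B : Hom (X ⊗ B) B := lunit B ∘ (counit X ⊠ 1_B).

(** In Sweedler notation, [(x ⊗ b) (y ⊗ c) = x (b_1 ▷ y) ⊗ b_2 c]. *)
Definition smash_mul : Hom ((X ⊗ B) ⊗ (X ⊗ B)) (X ⊗ B) := (mul X ⊠ mul B) ∘ mid theta.
Definition smash_unit : Hom 𝕀 (X ⊗ B) := (unit X ⊠ unit B) ∘ lunit_inv 𝕀.

(** At the unit of [B] the twist is trivial, so [X] acts from the left on its own factor only. The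
    unit laws and partial associativity axioms are reduced to such products with one factor from [X]
    or [B]. *)
Lemma smash_mul_inj_X_l : smash_mul ∘ (inj_X ⊠ 1_(X ⊗ B)) = (mul X ⊠ 1_B) ∘ assoc_inv X X B.
Proof.
  unfold smash_mul, mid, inj_X.
  transitivity ((mul X ⊠ mul B) ∘ assoc_inv X X (B ⊗ B)
    ∘ (1_X ⊠ (assoc X B B ∘ ((theta ∘ (unit B ⊠ 1_X)) ⊠ 1_B)))
    ∘ (1_X ⊠ (lunit_inv X ⊠ 1_B))).
  { monoidal. }
  rewrite theta_unit_l.
  transitivity ((mul X ⊠ (mul B ∘ (unit B ⊠ 1_B))) ∘ assoc_inv X X (𝕀 ⊗ B)
    ∘ (1_X ⊠ (1_X ⊠ lunit_inv B))).
  { monoidal. }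
  rewrite mul_unitl. monoidal.
Qed.

Lemma smash_mul_inj_X_r :
  smash_mul ∘ (1_(X ⊗ B) ⊠ inj_X) =
  (mul X ⊠ 1_B) ∘ assoc_inv X X B ∘ (1_X ⊠ theta) ∘ assoc X B X.
Proof.
  unfold smash_mul, mid, inj_X.
  transitivity ((mul X ⊠ (mul B ∘ (1_B ⊠ unit B))) ∘ assoc_inv X X (B ⊗ 𝕀)
    ∘ (1_X ⊠ (1_X ⊠ runit_inv B)) ∘ (1_X ⊠ theta) ∘ assoc X B X).
  { monoidal. }
  rewrite mul_unitr. monoidal.
Qed.

Lemma smash_mul_inj_B_l :
  smash_mul ∘ (inj_B ⊠ 1_(X ⊗ B)) =
  (1_X ⊠ mul B) ∘ assoc X B B ∘ (theta ⊠ 1_B) ∘ assoc_inv B X B.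
Proof.
  unfold smash_mul, mid, inj_B.
  transitivity (((mul X ∘ (unit X ⊠ 1_X)) ⊠ mul B) ∘ (lunit_inv X ⊠ 1_(B ⊗ B))
    ∘ assoc X B B ∘ (theta ⊠ 1_B) ∘ assoc_inv B X B).
  { monoidal. }
  rewrite mul_unitl. monoidal.
Qed.

Lemma smash_mul_inj_B_r : smash_mul ∘ (1_(X ⊗ B) ⊠ inj_B) = (1_X ⊠ mul B) ∘ assoc X B B.
Proof.
  unfold smash_mul, mid, inj_B.
  transitivity ((mul X ⊠ mul B) ∘ assoc_inv X X (B ⊗ B)
    ∘ (1_X ⊠ (assoc X B B ∘ ((theta ∘ (1_B ⊠ unit X)) ⊠ 1_B)))
    ∘ (1_X ⊠ (runit_inv B ⊠ 1_B)) ∘ assoc X B B).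
  { monoidal. }
  rewrite theta_unit_r.
  transitivity (((mul X ∘ (1_X ⊠ unit X)) ⊠ mul B) ∘ (runit_inv X ⊠ 1_(B ⊗ B))
    ∘ assoc X B B).
  { monoidal. }
  rewrite mul_unitr. monoidal.
Qed.

Lemma smash_mul_inj_X_inj_B : smash_mul ∘ (inj_X ⊠ inj_B) = 1_(X ⊗ B).
Proof.
  transitivity ((smash_mul ∘ (inj_X ⊠ 1_(X ⊗ B))) ∘ (1_X ⊠ inj_B)).
  { monoidal. }
  rewrite smash_mul_inj_X_l. unfold inj_B.
  transitivity (((mul X ∘ (1_X ⊠ unit X)) ⊠ 1_B) ∘ (runit_inv X ⊠ 1_B)).
  { monoidal. }
  rewrite mul_unitr. monoidal.
Qed.

(** So [theta] is the reordering of [e b · κ x]; its [X]-component is the original action. *)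
Lemma smash_mul_inj_B_inj_X : smash_mul ∘ (inj_B ⊠ inj_X) = theta.
Proof.
  transitivity ((smash_mul ∘ (inj_B ⊠ 1_(X ⊗ B))) ∘ (1_B ⊠ inj_X)).
  { monoidal. }
  rewrite smash_mul_inj_B_l. unfold inj_X.
  transitivity ((1_X ⊠ (mul B ∘ (1_B ⊠ unit B) ∘ runit_inv B)) ∘ theta).
  { monoidal. }
  rewrite mul_unitr. monoidal.
Qed.

Lemma smash_unit_inj_X : smash_unit = inj_X ∘ unit X.
Proof. unfold smash_unit, inj_X. monoidal. Qed.

Lemma smash_unit_inj_B : smash_unit = inj_B ∘ unit B.
Proof. unfold smash_unit, inj_B. monoidal. Qed.

Definition smash_alg : AlgebraOn (X ⊗ B).
Proof.
  refine {| mul := smash_mul; unit := smash_unit |}.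
  - rewrite smash_unit_inj_X.
    transitivity ((smash_mul ∘ (inj_X ⊠ 1_(X ⊗ B))) ∘ (unit X ⊠ 1_(X ⊗ B))).
    { monoidal. }
    rewrite smash_mul_inj_X_l.
    transitivity (((mul X ∘ (unit X ⊠ 1_X)) ⊠ 1_B) ∘ assoc_inv 𝕀 X B).
    { monoidal. }
    rewrite mul_unitl. monoidal.
  - rewrite smash_unit_inj_B.
    transitivity ((smash_mul ∘ (1_(X ⊗ B) ⊠ inj_B)) ∘ (1_(X ⊗ B) ⊠ unit B)).
    { monoidal. }
    rewrite smash_mul_inj_B_r.
    transitivity ((1_X ⊠ (mul B ∘ (1_B ⊠ unit B))) ∘ assoc X B 𝕀).
    { monoidal. }
    rewrite mul_unitr. monoidal.
Defined.

Local Notation XB := (coalg_tens X B).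

(** The multiplication is a composite of coalgebra morphisms, so its compatibility with [Δ] and [ε]
    needs no computation. *)
Lemma coalgebra_hom_smash_mul : is_coalgebra_hom (coalg_tens XB XB) XB smash_mul.
Proof.
  refine (coalgebra_hom_comp (coalgebra_hom_tens (coalgebra_hom_mul X)
    (coalgebra_hom_mul B)) _).
  refine (coalgebra_hom_comp _ (coalgebra_hom_assoc X B XB)).
  refine (coalgebra_hom_comp (coalgebra_hom_assoc_inv X X (coalg_tens B B)) _).
  apply coalgebra_hom_tens; [apply coalgebra_hom_id|].
  refine (coalgebra_hom_comp _ (coalgebra_hom_assoc_inv B X B)).
  refine (coalgebra_hom_comp (coalgebra_hom_assoc X B B) _).
  apply coalgebra_hom_tens; auto using coalgebra_hom_id, coalgebra_hom_theta.
Qed.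

Lemma coalgebra_hom_smash_unit : is_coalgebra_hom coalg_unit XB smash_unit.
Proof.
  refine (coalgebra_hom_comp _ (coalgebra_hom_lunit_inv coalg_unit)).
  apply coalgebra_hom_tens; apply coalgebra_hom_unit.
Qed.

Definition smash : Bialgebra C.
Proof.
  refine {| carrier := X ⊗ B; bialg_alg := smash_alg; bialg_coalg := XB |};
    cbn [mul unit smash_alg].
  - rewrite (proj1 coalgebra_hom_smash_mul). apply comp_assoc.
  - apply coalgebra_hom_smash_unit.
  - apply coalgebra_hom_smash_mul.
  - apply coalgebra_hom_smash_unit.
Defined.

(** * The structure maps of the split extension on the smash product *)

Definition smash_kappa : BialgHom X smash.
Proof.
  refine {| bh_map := inj_X : Hom X smash |};
    cbn [carrier bialg_alg bialg_coalg smash]; split; cbn [mul unit smash_alg].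
  - symmetry.
    transitivity ((smash_mul ∘ (inj_X ⊠ 1_(X ⊗ B))) ∘ (1_X ⊠ inj_X)).
    { monoidal. }
    rewrite smash_mul_inj_X_l. unfold inj_X. monoidal.
  - now rewrite smash_unit_inj_X.
  - refine (proj1 (coalgebra_hom_comp _ (coalgebra_hom_runit_inv X))).
    apply coalgebra_hom_tens; auto using coalgebra_hom_id, coalgebra_hom_unit.
  - refine (proj2 (coalgebra_hom_comp _ (coalgebra_hom_runit_inv X))).
    apply coalgebra_hom_tens; auto using coalgebra_hom_id, coalgebra_hom_unit.
Defined.

Definition smash_sect : BialgHom B smash.
Proof.
  refine {| bh_map := inj_B : Hom B smash |};
    cbn [carrier bialg_alg bialg_coalg smash].
  - split; cbn [mul unit smash_alg].
    + symmetry.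
      transitivity ((smash_mul ∘ (1_(X ⊗ B) ⊠ inj_B)) ∘ (inj_B ⊠ 1_B)).
      { monoidal. }
      rewrite smash_mul_inj_B_r. unfold inj_B. monoidal.
    + now rewrite smash_unit_inj_B.
  - refine (coalgebra_hom_comp _ (coalgebra_hom_lunit_inv B)).
    apply coalgebra_hom_tens; auto using coalgebra_hom_id, coalgebra_hom_unit.
Defined.

Lemma coalgebra_hom_proj_X : is_coalgebra_hom XB X proj_X.
Proof.
  refine (coalgebra_hom_comp (coalgebra_hom_runit X) _).
  apply coalgebra_hom_tens; auto using coalgebra_hom_id, coalgebra_hom_counit.
Qed.

Lemma coalgebra_hom_proj_B : is_coalgebra_hom XB B proj_B.
Proof.
  refine (coalgebra_hom_comp (coalgebra_hom_lunit B) _).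
  apply coalgebra_hom_tens; auto using coalgebra_hom_id, coalgebra_hom_counit.
Qed.

Definition smash_alpha : BialgHom smash B.
Proof.
  refine {| bh_map := proj_B : Hom smash B |};
    cbn [carrier bialg_alg bialg_coalg smash]; [|apply coalgebra_hom_proj_B].
  split; cbn [mul unit smash_alg].
  - unfold smash_mul, proj_B, mid.
    transitivity (lunit B ∘ ((counit X ∘ mul X) ⊠ mul B)
      ∘ assoc_inv X X (B ⊗ B) ∘ (1_X ⊠ (assoc X B B ∘ (theta ⊠ 1_B) ∘ assoc_inv B X B))
      ∘ assoc X B (X ⊗ B)).
    { monoidal. }
    (* The counit of [X] splits over the product, and applied after [theta] it leaves [act_proj]. *)
    rewrite counit_mul.
    transitivity (mul B ∘ (((lunit B ∘ (counit X ⊠ 1_B) ∘ theta) ⊠ 1_B))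
      ∘ assoc_inv B X B ∘ lunit (B ⊗ (X ⊗ B))
      ∘ (counit X ⊠ 1_(B ⊗ (X ⊗ B))) ∘ assoc X B (X ⊗ B)).
    { monoidal. }
    rewrite theta_counit_l. unfold act_proj. monoidal.
  - unfold smash_unit, proj_B.
    transitivity (unit B ∘ lunit 𝕀 ∘ ((counit X ∘ unit X) ⊠ 1_𝕀) ∘ lunit_inv 𝕀).
    { monoidal. }
    rewrite counit_unit. monoidal.
Defined.

Lemma proj_X_inj_X : proj_X ∘ inj_X = 1_X.
Proof.
  unfold proj_X, inj_X.
  transitivity (runit X ∘ (1_X ⊠ (counit B ∘ unit B)) ∘ runit_inv X).
  { monoidal. }
  rewrite counit_unit. monoidal.
Qed.

Lemma proj_B_inj_B : proj_B ∘ inj_B = 1_B.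
Proof.
  unfold proj_B, inj_B.
  transitivity (lunit B ∘ ((counit X ∘ unit X) ⊠ 1_B) ∘ lunit_inv B).
  { monoidal. }
  rewrite counit_unit. monoidal.
Qed.

(** The map sends [x ⊗ b] to [x_1 ε(b_1) ⊗ ε(x_2) b_2], so the counit laws apply. It yields the
    decomposition axiom and, for a general extension, one half of the comparison isomorphism. *)
Lemma proj_pair_comul : (proj_X ⊠ proj_B) ∘ comul XB = 1_(X ⊗ B).
Proof.
  unfold proj_X, proj_B. cbn [comul coalg_tens].
  transitivity ((runit X ⊠ lunit B)
    ∘ (((1_X ⊠ counit B) ⊠ (counit X ⊠ 1_B)) ∘ mid_swap X X B B)
    ∘ (comul X ⊠ comul B)).
  { monoidal. }
  rewrite <- mid_swap_natural.
  transitivity ((1_X ⊠ lunit B) ∘ ((runit X ⊠ 1_(𝕀 ⊗ B)) ∘ mid_swap X 𝕀 𝕀 B)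
    ∘ (((1_X ⊠ counit X) ∘ comul X) ⊠ ((counit B ⊠ 1_B) ∘ comul B))).
  { monoidal. }
  rewrite mid_swap_unit_3.
  transitivity ((runit X ∘ (1_X ⊠ counit X) ∘ comul X) ⊠
    (lunit B ∘ (counit B ⊠ 1_B) ∘ comul B)).
  { monoidal. }
  now rewrite comul_counitl, comul_counitr, tensh_id.
Qed.

End Smash.

(** * The equivalence *)

Section Equivalence.
Context {C : SymMonCat}.

Lemma algebra_hom_inv {X Y : Obj C} {a : AlgebraOn X} {b : AlgebraOn Y}
    {f : Hom X Y} {g : Hom Y X} :
  f ∘ g = 1_Y -> g ∘ f = 1_X -> is_algebra_hom a b f -> is_algebra_hom b a g.
Proof.
  intros Hfg Hgf [f1 f2]; split.
  - apply (split_mono_cancel Hgf).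
    now rewrite !comp_assoc, f1, Hfg, comp_idl, <- comp_assoc, <- tensh_comp, Hfg,
      tensh_id, comp_idr.
  - apply (split_mono_cancel Hgf).
    now rewrite f2, comp_assoc, Hfg, comp_idl.
Qed.

(** * The functor from actions to split extensions *)

Definition smash_ext (S : Action C) : SplitExtension C.
Proof.
  refine {| kappa := smash_kappa S; alpha := smash_alpha S; sect := smash_sect S;
            lambda := proj_X S : Hom (smash S) (act_X S) |};
    cbn [bh_map smash_kappa smash_alpha smash_sect carrier smash bialg_alg bialg_coalg
         mul unit smash_alg].
  - apply proj_X_inj_X.
  - apply proj_B_inj_B.
  - unfold proj_X, inj_B. monoidal.
  - unfold proj_B, inj_X. monoidal.
  - transitivity (smash_mul S ∘ (inj_X S ⊠ inj_B S) ∘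
      ((proj_X S ⊠ proj_B S) ∘ comul (coalg_tens (act_X S) (act_B S)))).
    { monoidal. }
    now rewrite smash_mul_inj_X_inj_B, proj_pair_comul, comp_idl.
  - now rewrite <- comp_assoc, smash_mul_inj_X_inj_B, comp_idr.
  (* Here [λ (e b · κ x)] is [b ▷ x], so this axiom is [act_sym]. *)
  - transitivity ((1_(act_B S) ⊠ (proj_X S ∘ (smash_mul S ∘ (inj_B S ⊠ inj_X S))))
      ∘ assoc (act_B S) (act_B S) (act_X S) ∘ (comul (act_B S) ⊠ 1_(act_X S))).
    { monoidal. }
    rewrite smash_mul_inj_B_inj_X. unfold proj_X.
    rewrite theta_counit_r, act_sym, <- theta_counit_r, <- smash_mul_inj_B_inj_X.
    fold (proj_X S). monoidal.
  - transitivity (smash_mul S ∘ ((smash_mul S ∘ (inj_X S ⊠ inj_B S)) ⊠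
      1_(act_X S ⊗ act_B S))).
    { monoidal. }
    rewrite smash_mul_inj_X_inj_B, tensh_id, comp_idr. symmetry.
    transitivity ((smash_mul S ∘ (inj_X S ⊠ 1_(act_X S ⊗ act_B S)))
      ∘ (1_(act_X S) ⊠ (smash_mul S ∘ (inj_B S ⊠ 1_(act_X S ⊗ act_B S))))
      ∘ assoc (act_X S) (act_B S) (act_X S ⊗ act_B S)).
    { monoidal. }
    rewrite smash_mul_inj_X_l, smash_mul_inj_B_l.
    unfold smash_mul, mid. monoidal.
  (* Left multiplication by [κ x] affects only the factor [X] and right multiplication by [e b] only
     the factor [B], so the two commute. *)
  - transitivity ((smash_mul S ∘ (1_(act_X S ⊗ act_B S) ⊠ inj_B S))
      ∘ ((smash_mul S ∘ (inj_X S ⊠ 1_(act_X S ⊗ act_B S))) ⊠ 1_(act_B S))).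
    { monoidal. }
    transitivity ((smash_mul S ∘ (inj_X S ⊠ 1_(act_X S ⊗ act_B S)))
      ∘ (1_(act_X S) ⊠ (smash_mul S ∘ (1_(act_X S ⊗ act_B S) ⊠ inj_B S)))
      ∘ assoc (act_X S) (act_X S ⊗ act_B S) (act_B S)).
    2: monoidal.
    rewrite smash_mul_inj_X_l, smash_mul_inj_B_r. monoidal.
  - transitivity ((smash_mul S ∘ (1_(act_X S ⊗ act_B S) ⊠ inj_B S))
      ∘ ((smash_mul S ∘ (1_(act_X S ⊗ act_B S) ⊠ inj_X S)) ⊠ 1_(act_B S))).
    { monoidal. }
    transitivity (smash_mul S
      ∘ (1_(act_X S ⊗ act_B S) ⊠ (smash_mul S ∘ (inj_X S ⊠ inj_B S)))
      ∘ assoc (act_X S ⊗ act_B S) (act_X S) (act_B S)).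
    2: monoidal.
    rewrite smash_mul_inj_X_inj_B, smash_mul_inj_X_r, smash_mul_inj_B_r.
    unfold smash_mul, mid. monoidal.
  - apply coalgebra_hom_proj_X.
  - unfold proj_X, smash_unit.
    transitivity (unit (act_X S) ∘ runit 𝕀 ∘
      (1_𝕀 ⊠ (counit (act_B S) ∘ unit (act_B S))) ∘ lunit_inv 𝕀).
    { monoidal. }
    rewrite counit_unit. monoidal.
Defined.

Lemma theta_natural {S T : Action C} (f : ActionHom S T) :
  theta T ∘ (ah_g f ⊠ ah_v f) = (ah_v f ⊠ ah_g f) ∘ theta S.
Proof.
  rewrite (comul_tens_comp (bh_coalg (ah_g f)) (bh_coalg (ah_v f))), <- ah_act.
  unfold theta, act_proj.
  transitivity (((ah_v f ∘ act S) ⊠ (runit (act_B T) ∘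
    (ah_g f ⊠ (counit (act_X T) ∘ ah_v f))))
    ∘ comul (coalg_tens (act_B S) (act_X S))).
  { monoidal. }
  rewrite (proj2 (bh_coalg (ah_v f))). monoidal.
Qed.

Definition smash_hom {S T : Action C} (f : ActionHom S T) :
  BialgHom (smash S) (smash T).
Proof.
  refine {| bh_map := (ah_v f ⊠ ah_g f) : Hom (smash S) (smash T) |};
    cbn [carrier bialg_alg bialg_coalg smash].
  - destruct (bh_alg (ah_v f)) as [Vm Vu], (bh_alg (ah_g f)) as [Gm Gu].
    split; cbn [mul unit smash_alg]; unfold smash_mul, smash_unit.
    + rewrite comp_assoc, <- tensh_comp, Vm, Gm, tensh_comp, <- !comp_assoc.
      f_equal. symmetry. apply mid_natural, theta_natural.
    + now rewrite comp_assoc, <- tensh_comp, Vu, Gu.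
  - apply coalgebra_hom_tens; apply bh_coalg.
Defined.

Definition smash_ext_hom {S T : Action C} (f : ActionHom S T) :
  SplitExtHom (smash_ext S) (smash_ext T).
Proof.
  refine {| sh_g := ah_g f : BialgHom (se_B (smash_ext S)) (se_B (smash_ext T));
            sh_v := ah_v f : BialgHom (se_X (smash_ext S)) (se_X (smash_ext T));
            sh_p := smash_hom f : BialgHom (se_A (smash_ext S)) (se_A (smash_ext T)) |};
    cbn [bh_map smash_hom smash_ext kappa alpha sect lambda smash_kappa smash_alpha
         smash_sect se_A se_B se_X carrier smash];
    unfold inj_X, inj_B, proj_X, proj_B.
  - rewrite <- (proj2 (bh_alg (ah_g f))). monoidal.
  - rewrite <- (proj2 (bh_alg (ah_v f))). monoidal.
  - rewrite <- (proj2 (bh_coalg (ah_v f))). monoidal.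
  - rewrite <- (proj2 (bh_coalg (ah_g f))). monoidal.
Defined.

Definition ActToSplitExt : Functor (Act C) (SplitExt C).
Proof.
  refine (@Build_Functor (Act C) (SplitExt C) smash_ext (@smash_ext_hom) _ _).
  - intros S. apply split_ext_hom_eq; try reflexivity. apply tensh_id.
  - intros S T U f g. apply split_ext_hom_eq; try reflexivity. apply tensh_comp.
Defined.

(** * The action of a split extension, and the comparison with its smash product *)

Section Extension.
Variable E : SplitExtension C.
Local Notation A := (se_A E).
Local Notation B := (se_B E).
Local Notation X := (se_X E).
Local Notation κ := (bh_map (kappa E)).
Local Notation α := (bh_map (alpha E)).
Local Notation e := (bh_map (sect E)).
Local Notation λ := (lambda E).

Lemma coalgebra_hom_mul_sect_kappa :
  is_coalgebra_hom (coalg_tens B X) A (mul A ∘ (e ⊠ κ)).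
Proof.
  refine (coalgebra_hom_comp (coalgebra_hom_mul A) _).
  apply coalgebra_hom_tens; apply bh_coalg.
Qed.

Lemma coalgebra_hom_ext_act :
  is_coalgebra_hom (coalg_tens B X) X (λ ∘ (mul A ∘ (e ⊠ κ))).
Proof.
  exact (coalgebra_hom_comp (lambda_coalg E) coalgebra_hom_mul_sect_kappa).
Qed.

Definition ext_action : Action C.
Proof.
  refine {| act := λ ∘ (mul A ∘ (e ⊠ κ)) |}.
  - transitivity (λ ∘ (mul A ∘ ((e ∘ unit B) ⊠ 1_A)) ∘ (1_𝕀 ⊠ κ)).
    { monoidal. }
    rewrite (proj2 (bh_alg (sect E))), mul_unitl.
    rewrite <- comp_assoc, lunit_natural, comp_assoc, lambda_kappa. apply comp_idl.
  - transitivity (λ ∘ (mul A ∘ (1_A ⊠ (κ ∘ unit X))) ∘ (e ⊠ 1_𝕀)).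
    { monoidal. }
    rewrite (proj2 (bh_alg (kappa E))), mul_unitr.
    now rewrite <- comp_assoc, runit_natural, comp_assoc, lambda_sect.
  - etransitivity; [|etransitivity; [exact (se_sym E)|]]; monoidal.
  - apply coalgebra_hom_ext_act.
  - rewrite (proj1 coalgebra_hom_ext_act). apply comp_assoc.
Defined.

Definition smash_to_ext : Hom (X ⊗ B) A := mul A ∘ (κ ⊠ e).
Definition ext_to_smash : Hom A (X ⊗ B) := (λ ⊠ α) ∘ comul A.

Lemma smash_to_ext_to_smash : smash_to_ext ∘ ext_to_smash = 1_A.
Proof.
  rewrite <- (se_decomp E). unfold smash_to_ext, ext_to_smash. monoidal.
Qed.

Lemma coalgebra_hom_smash_to_ext :
  is_coalgebra_hom (coalg_tens X B) A smash_to_ext.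
Proof.
  refine (coalgebra_hom_comp (coalgebra_hom_mul A) _).
  apply coalgebra_hom_tens; apply bh_coalg.
Qed.

Lemma lambda_smash_to_ext : λ ∘ smash_to_ext = runit X ∘ (1_X ⊠ counit B).
Proof. unfold smash_to_ext. rewrite comp_assoc. apply lambda_mul. Qed.

Lemma alpha_smash_to_ext : α ∘ smash_to_ext = lunit B ∘ (counit X ⊠ 1_B).
Proof.
  unfold smash_to_ext.
  rewrite comp_assoc, (proj1 (bh_alg (alpha E))), <- comp_assoc, <- tensh_comp.
  rewrite alpha_kappa, alpha_sect, <- (mul_unitl B). monoidal.
Qed.

(** As a coalgebra morphism, [smash_to_ext] passes through [Δ]; composed with [λ] and [α] it becomes
    the two projections, and [proj_pair_comul] applies. *)
Lemma ext_to_smash_to_ext : ext_to_smash ∘ smash_to_ext = 1_(X ⊗ B).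
Proof.
  unfold ext_to_smash.
  rewrite <- comp_assoc, (proj1 coalgebra_hom_smash_to_ext), comp_assoc, <- tensh_comp.
  rewrite lambda_smash_to_ext, alpha_smash_to_ext. apply (proj_pair_comul ext_action).
Qed.

(** This is the decomposition [1_A = m (κ λ ⊗ e α) Δ] applied to [e b · κ x]. *)
Lemma smash_to_ext_theta : smash_to_ext ∘ theta ext_action = mul A ∘ (e ⊠ κ).
Proof.
  transitivity (smash_to_ext ∘ ext_to_smash ∘ (mul A ∘ (e ⊠ κ))).
  2: now rewrite smash_to_ext_to_smash, comp_idl.
  rewrite <- comp_assoc. f_equal. unfold ext_to_smash.
  rewrite <- comp_assoc, (proj1 coalgebra_hom_mul_sect_kappa), comp_assoc, <- tensh_comp.
  unfold theta. f_equal. f_equal. symmetry.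
  rewrite comp_assoc, (proj1 (bh_alg (alpha E))), <- comp_assoc, <- tensh_comp.
  rewrite alpha_kappa, alpha_sect. unfold act_proj. cbn [act_B act_X ext_action].
  rewrite <- (mul_unitr B). monoidal.
Qed.

(** With [y' ⊗ b'] for [theta (b ⊗ y)]: [κ (x y') · e (b' c)] is [(κ x · κ y') · (e b' · e c)], then
    [κ x · (κ y' · (e b' · e c))], then [κ x · ((κ y' · e b') · e c)]. By [smash_to_ext_theta] this
    is [κ x · ((e b · κ y) · e c)], which becomes [κ x · (e b · (κ y · e c))] and finally
    [(κ x · e b) · (κ y · e c)]. Every rebracketing is one of the three partial associativity
    axioms. *)
Lemma smash_to_ext_mul :
  smash_to_ext ∘ smash_mul ext_action = mul A ∘ (smash_to_ext ⊠ smash_to_ext).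
Proof.
  unfold smash_mul, mid. cbn [act_B act_X ext_action]. unfold smash_to_ext at 1.
  transitivity (mul A ∘ ((κ ∘ mul X) ⊠ (e ∘ mul B)) ∘ assoc_inv X X (B ⊗ B)
    ∘ (1_X ⊠ (assoc X B B ∘ (theta ext_action ⊠ 1_B) ∘ assoc_inv B X B))
    ∘ assoc X B (X ⊗ B)).
  { monoidal. }
  rewrite (proj1 (bh_alg (kappa E))).
  transitivity (mul A ∘ (mul A ⊠ 1_A) ∘ ((κ ⊠ 1_A) ⊠ e) ∘ ((1_X ⊠ κ) ⊠ mul B)
    ∘ assoc_inv X X (B ⊗ B)
    ∘ (1_X ⊠ (assoc X B B ∘ (theta ext_action ⊠ 1_B) ∘ assoc_inv B X B))
    ∘ assoc X B (X ⊗ B)).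
  { monoidal. }
  rewrite se_assoc_kappa_id_sect.
  transitivity (mul A ∘ (κ ⊠ (mul A ∘ (κ ⊠ (e ∘ mul B))))
    ∘ (1_X ⊠ (assoc X B B ∘ (theta ext_action ⊠ 1_B) ∘ assoc_inv B X B))
    ∘ assoc X B (X ⊗ B)).
  { monoidal. }
  rewrite (proj1 (bh_alg (sect E))).
  transitivity (mul A ∘ (κ ⊠ (mul A ∘ (1_A ⊠ mul A) ∘ assoc A A A
      ∘ ((κ ⊠ e) ⊠ 1_A) ∘ (1_(X ⊗ B) ⊠ e)))
    ∘ (1_X ⊠ ((theta ext_action ⊠ 1_B) ∘ assoc_inv B X B))
    ∘ assoc X B (X ⊗ B)).
  { monoidal. }
  rewrite <- se_assoc_kappa_sect_id.
  transitivity (mul A ∘ (κ ⊠ (mul A ∘ ((smash_to_ext ∘ theta ext_action) ⊠ e)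
    ∘ assoc_inv B X B)) ∘ assoc X B (X ⊗ B)).
  { unfold smash_to_ext. monoidal. }
  rewrite smash_to_ext_theta.
  transitivity (mul A ∘ (κ ⊠ (mul A ∘ (mul A ⊠ 1_A) ∘ ((1_A ⊠ κ) ⊠ e)
    ∘ ((e ⊠ 1_X) ⊠ 1_B) ∘ assoc_inv B X B)) ∘ assoc X B (X ⊗ B)).
  { monoidal. }
  rewrite se_assoc_id_kappa_sect.
  transitivity (mul A ∘ (1_A ⊠ mul A) ∘ assoc A A A ∘ ((κ ⊠ e) ⊠ 1_A)
    ∘ (1_(X ⊗ B) ⊠ smash_to_ext)).
  { unfold smash_to_ext. monoidal. }
  rewrite <- se_assoc_kappa_sect_id. unfold smash_to_ext. monoidal.
Qed.

Lemma smash_to_ext_unit : smash_to_ext ∘ smash_unit ext_action = unit A.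
Proof.
  unfold smash_to_ext, smash_unit. cbn [act_B act_X ext_action].
  transitivity (mul A ∘ ((κ ∘ unit X) ⊠ (e ∘ unit B)) ∘ lunit_inv 𝕀).
  { monoidal. }
  rewrite (proj2 (bh_alg (kappa E))), (proj2 (bh_alg (sect E))).
  transitivity (mul A ∘ (unit A ⊠ 1_A) ∘ (1_𝕀 ⊠ unit A) ∘ lunit_inv 𝕀).
  { monoidal. }
  rewrite mul_unitl. monoidal.
Qed.

Lemma smash_to_ext_inj_X : smash_to_ext ∘ inj_X ext_action = κ.
Proof.
  unfold smash_to_ext, inj_X. cbn [act_B act_X ext_action].
  transitivity (mul A ∘ (1_A ⊠ (e ∘ unit B)) ∘ (κ ⊠ 1_𝕀) ∘ runit_inv X).
  { monoidal. }
  rewrite (proj2 (bh_alg (sect E))), mul_unitr. monoidal.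
Qed.

Lemma smash_to_ext_inj_B : smash_to_ext ∘ inj_B ext_action = e.
Proof.
  unfold smash_to_ext, inj_B. cbn [act_B act_X ext_action].
  transitivity (mul A ∘ ((κ ∘ unit X) ⊠ 1_A) ∘ (1_𝕀 ⊠ e) ∘ lunit_inv B).
  { monoidal. }
  rewrite (proj2 (bh_alg (kappa E))), mul_unitl. monoidal.
Qed.

Lemma ext_to_smash_kappa : ext_to_smash ∘ κ = inj_X ext_action.
Proof.
  rewrite <- smash_to_ext_inj_X, comp_assoc, ext_to_smash_to_ext. apply comp_idl.
Qed.

Lemma ext_to_smash_sect : ext_to_smash ∘ e = inj_B ext_action.
Proof.
  rewrite <- smash_to_ext_inj_B, comp_assoc, ext_to_smash_to_ext. apply comp_idl.
Qed.

Lemma proj_B_ext_to_smash : proj_B ext_action ∘ ext_to_smash = α.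
Proof.
  change (proj_B ext_action) with (lunit B ∘ (counit X ⊠ 1_B)).
  rewrite <- alpha_smash_to_ext, <- comp_assoc, smash_to_ext_to_smash. apply comp_idr.
Qed.

Lemma proj_X_ext_to_smash : proj_X ext_action ∘ ext_to_smash = λ.
Proof.
  change (proj_X ext_action) with (runit X ∘ (1_X ⊠ counit B)).
  rewrite <- lambda_smash_to_ext, <- comp_assoc, smash_to_ext_to_smash. apply comp_idr.
Qed.

Definition smash_to_ext_bialg : BialgHom (smash ext_action) A.
Proof.
  refine {| bh_map := smash_to_ext : Hom (smash ext_action) A |};
    cbn [carrier bialg_alg bialg_coalg smash].
  - split; [apply smash_to_ext_mul | apply smash_to_ext_unit].
  - apply coalgebra_hom_smash_to_ext.
Defined.

(** As [λ] is not assumed multiplicative, compatibility with the products is inherited from the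
    inverse [smash_to_ext]. *)
Definition ext_to_smash_bialg : BialgHom A (smash ext_action).
Proof.
  refine {| bh_map := ext_to_smash : Hom A (smash ext_action) |};
    cbn [carrier bialg_alg bialg_coalg smash].
  - refine (algebra_hom_inv smash_to_ext_to_smash ext_to_smash_to_ext _).
    exact (bh_alg smash_to_ext_bialg).
  - refine (coalgebra_hom_inv smash_to_ext_to_smash ext_to_smash_to_ext _).
    apply coalgebra_hom_smash_to_ext.
Defined.

Definition counit_iso : SplitExtHom (smash_ext ext_action) E.
Proof.
  refine {| sh_g := bialg_id B : BialgHom (se_B (smash_ext ext_action)) B;
            sh_v := bialg_id X : BialgHom (se_X (smash_ext ext_action)) X;
            sh_p := smash_to_ext_bialg : BialgHom (se_A (smash_ext ext_action)) A |};
    cbn [bh_map bialg_id smash_to_ext_bialg smash_ext kappa alpha sect lambda smash_kappa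
         smash_alpha smash_sect se_A se_B se_X carrier smash]; rewrite ?comp_idl, ?comp_idr.
  - apply smash_to_ext_inj_X.
  - apply smash_to_ext_inj_B.
  - apply alpha_smash_to_ext.
  - apply lambda_smash_to_ext.
Defined.

Definition counit_iso_inv : SplitExtHom E (smash_ext ext_action).
Proof.
  refine {| sh_g := bialg_id B : BialgHom B (se_B (smash_ext ext_action));
            sh_v := bialg_id X : BialgHom X (se_X (smash_ext ext_action));
            sh_p := ext_to_smash_bialg : BialgHom A (se_A (smash_ext ext_action)) |};
    cbn [bh_map bialg_id ext_to_smash_bialg smash_ext kappa alpha sect lambda smash_kappa
         smash_alpha smash_sect se_A se_B se_X carrier smash]; rewrite ?comp_idl, ?comp_idr.
  - apply ext_to_smash_kappa.
  - apply ext_to_smash_sect.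
  - apply proj_B_ext_to_smash.
  - apply proj_X_ext_to_smash.
Defined.

End Extension.

(** * The functor from split extensions to actions, and the round trip on actions *)

Definition ext_action_hom {S T : SplitExtension C} (f : SplitExtHom S T) :
  ActionHom (ext_action S) (ext_action T).
Proof.
  refine {| ah_g := sh_g f : BialgHom (act_B (ext_action S)) (act_B (ext_action T));
            ah_v := sh_v f : BialgHom (act_X (ext_action S)) (act_X (ext_action T)) |}.
  cbn [act act_B act_X ext_action].
  rewrite comp_assoc, <- sh_lambda, <- (comp_assoc (lambda T)), (comp_assoc (sh_p f)).
  rewrite (proj1 (bh_alg (sh_p f))), <- !comp_assoc, <- !tensh_comp.
  now rewrite sh_kappa, sh_sect.
Defined.

Definition SplitExtToAct : Functor (SplitExt C) (Act C).
Proof.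
  refine (@Build_Functor (SplitExt C) (Act C) ext_action (@ext_action_hom) _ _);
    intros; apply action_hom_eq; reflexivity.
Defined.

Lemma ext_action_smash_ext (S : Action C) :
  act (ext_action (smash_ext S)) = act S.
Proof.
  change (proj_X S ∘ (smash_mul S ∘ (inj_B S ⊠ inj_X S)) = act S).
  rewrite smash_mul_inj_B_inj_X. apply theta_counit_r.
Qed.

(** The round trip preserves [B], [X] and the action map, so identities serve as components. *)
Definition unit_iso (S : Action C) : ActionHom (ext_action (smash_ext S)) S.
Proof.
  refine {| ah_g := bialg_id (act_B S)
              : BialgHom (act_B (ext_action (smash_ext S))) (act_B S);
            ah_v := bialg_id (act_X S)
              : BialgHom (act_X (ext_action (smash_ext S))) (act_X S) |}.
  cbn [bialg_id bh_map].
  now rewrite tensh_id, comp_idr, comp_idl, ext_action_smash_ext.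
Defined.

Definition unit_iso_inv (S : Action C) : ActionHom S (ext_action (smash_ext S)).
Proof.
  refine {| ah_g := bialg_id (act_B S)
              : BialgHom (act_B S) (act_B (ext_action (smash_ext S)));
            ah_v := bialg_id (act_X S)
              : BialgHom (act_X S) (act_X (ext_action (smash_ext S))) |}.
  cbn [bialg_id bh_map].
  now rewrite tensh_id, comp_idr, comp_idl, ext_action_smash_ext.
Defined.

End Equivalence.

Theorem theorem2p19 (C : SymMonCat) :
  equivalent_categories (SplitExt C) (Act C).
Proof.
  exists SplitExtToAct, ActToSplitExt; split; constructor.
  - refine (@Build_NatIso (SplitExt C) (SplitExt C)
      (functor_comp ActToSplitExt SplitExtToAct)
      (functor_id _) (@counit_iso C) (@counit_iso_inv C) _ _ _).
    + intros S T f. apply split_ext_hom_eq.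
      1, 2: exact (eq_trans (comp_idl _) (eq_sym (comp_idr _))).
      (* The component on [A] is [κ x · e b]; it is natural because [sh_p f] is multiplicative and
         commutes with [κ] and [e]. *)
      cbn. unfold smash_to_ext.
      rewrite <- comp_assoc, <- tensh_comp, comp_assoc, (proj1 (bh_alg (sh_p f))).
      now rewrite <- (comp_assoc (mul (se_A T))), <- tensh_comp, sh_kappa, sh_sect.
    + intros S. apply split_ext_hom_eq; try apply comp_idl. apply smash_to_ext_to_smash.
    + intros S. apply split_ext_hom_eq; try apply comp_idl. apply ext_to_smash_to_ext.
  - refine (@Build_NatIso (Act C) (Act C)
      (functor_comp SplitExtToAct ActToSplitExt)
      (functor_id _) (@unit_iso C) (@unit_iso_inv C) _ _ _).
    + intros S T f.
      apply action_hom_eq; exact (eq_trans (comp_idl _) (eq_sym (comp_idr _))).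
    + intros S. apply action_hom_eq; apply comp_idl.
    + intros S. apply action_hom_eq; apply comp_idl.
Qed.
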